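(* In Problem P1 or P2, for any fixed policy $\Gamma^2$ of O2, an optimal policy for O1 can be characterized by at most 4 thresholds. In particular, without any loss in performance, one can assume O1's policy to be of the following form: $$Z^1_{T^1}=\begin{cases}1 & \text{if } \pi^1_{T^1}\le \alpha_{T^1}\\ 0 & \text{if } \pi^1_{T^1}>\alpha_{T^1}\end{cases}$$ where $0\le\alpha_{T^1}\le 1$, and for $k=1,2,\dots,T^1-1$, $$Z^1_k=\begin{cases} b & \text{if } \pi^1_k<\alpha_k\\ 1 & \text{if } \alpha_k\le\pi^1_k\le\beta_k\\ b & \text{if } \beta_k<\pi^1_k<\delta_k\\ 0 & \text{if } \delta_k\le\pi^1_k\le\theta_k\\ b & \text{if } \pi^1_k>\theta_k\end{cases}$$ where $0\le\alpha_k\le\beta_k\le\delta_k\le\theta_k\le1$.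
   Context: **Model.** $H\in\{0,1\}$ is random with known prior $P(H=0)=p_0$, $P(H=1)=1-p_0$. There are two observers O1, O2. $Y^i_t\in\mathcal{Y}^i$ is the observation of O$i$ at time $t$; given $H$, it has either a discrete distribution $P^i_t(\cdot|H)$ or a density $f^i_t(\cdot|H)$. Given $H$, the observations of each observer at different times are independent, and the two observation sequences are independent. $X_{1:t}$ denotes $X_1,\dots,X_t$; $b$ is a blank message (no transmission). **O1.** As long as it has not sent a final message, at time $t$ O1 chooses $Z^1_t=\gamma^1_t(Y^1_{1:t})\in\{0,1,b\}$; $\tau^1=\min\{t: Z^1_t\in\{0,1\}\}$. The horizon constraint is $\tau^1\le T^1<\infty$ (at time $T^1$ O1 must send $0$ or $1$ if it has not done so before). A policy is $\Gamma^1=(\gamma^1_1,\dots,\gamma^1_{T^1})$. O1 sends only this single final message and gets no feedback from O2. O1's belief is $\pi^1_t=P(H=0|Y^1_{1:t})$. **Problem P1.** O2 first waits for O1's final message and only then takes its own measurements: after $k=0,1,2,\dots$ of its own measurements it chooses $U^2_k=\gamma^2_k(Y^2_{1:k},Z^1_{1:\tau^1})\in\{0,1,N\}$, where $N$ means ''continue''. $\tau^2=\min\{k:U^2_k\in\{0,1\}\}\le T^2<\infty$. A policy is $\Gamma^2=(\gamma^2_0,\dots,\gamma^2_{T^2})$. **Problem P2.** O2 takes measurements from time $t=1$; at each time $t$, after O1's action at time $t$, O2 chooses $U^2_t=\gamma^2_t(Y^2_{1:t},Z^1_{1:t})\in\{0,1,N\}$, where for $t>\tau^1$ the sequence $Z^1_{1:t}$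 is understood as $Z^1_{1:\tau^1}$. $\tau^2=\min\{t:U^2_t\in\{0,1\}\}\le T^2$, with $T^1\le T^2<\infty$. O2 may stop before O1 does. A policy is $\Gamma^2=(\gamma^2_1,\dots,\gamma^2_{T^2})$. **Objective (both problems).** Minimize $\mathbb{E}^{\Gamma^1,\Gamma^2}\{c^1\tau^1+c^2\tau^2+J(U^2_{\tau^2},H)\}$, where $c^1,c^2$ are finite positive numbers, $0\le J\le L<\infty$, $J(0,1)>J(1,1)$ and $J(1,0)>J(0,0)$. For fixed $\Gamma^2$, an optimal policy for O1 is a $\Gamma^1$ minimizing this cost.
   Formalization: The displayed form fails if O2 reverses the meaning of 0 and 1 (e.g. declares 1−Z¹); it is proved up to exchanging the names 0 and 1 of the final message at times when, given some H, sending the false value is strictly better for O1, with no loss if O2's policy is renamed alike. *)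

(* Defs.v *)
From HB Require Import structures.
From mathcomp Require Import all_boot all_order all_algebra.
From mathcomp Require Import all_classical all_reals all_analysis.

Set Implicit Arguments.
Unset Strict Implicit.
Unset Printing Implicit Defensive.

Import Order.TTheory GRing.Theory Num.Theory.

Local Open Scope classical_set_scope.
Local Open Scope ring_scope.

(** Hypotheses, final messages and final decisions are booleans, [false] being
    0 and [true] being 1.  In an [option bool], [None] is the blank message b
    of O1, or the "continue" action N of O2.  Observations are indexed from 1:
    the value at index 0 of an observation sequence is never used. *)

Inductive problem := P1 | P2.

Definition obs (E : Type) (t : nat) (y : nat -> E) : t.-tuple E :=
  [tuple y i.+1 | i < t].

Definition policy1 (E : Type) := forall t : nat, t.-tuple E -> option bool.

(** The second argument is the list of messages received so far from O1. *)
Definition policy2 (E : Type) :=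
  forall t : nat, t.-tuple E -> seq (option bool) -> option bool.

(** The least t in {a, ..., n} such that p t, and a junk value if there is
    none. *)
Definition first_time (p : pred nat) (a n : nat) : nat :=
  (a + find p (iota a (n.+1 - a)))%N.

Section run.
Context {E1 E2 : Type}.

Definition tau1 (T1 : nat) (g1 : policy1 E1) (y1 : nat -> E1) : nat :=
  first_time (fun t => g1 t (obs t y1) != None) 1 T1.

(** Z^1_1, ..., Z^1_tau1 *)
Definition messages (T1 : nat) (g1 : policy1 E1) (y1 : nat -> E1) :
    seq (option bool) :=
  [seq g1 s (obs s y1) | s <- iota 1 (tau1 T1 g1 y1)].

(** The part of the messages z of O1 that O2 knows at its stage t.  In problem
    P1 stage t comes after all of z and after t observations of O2; in problem
    P2 the two observers share the same clock, and [take t z] is all of z when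
    t exceeds the stopping time of O1. *)
Definition received (pb : problem) (t : nat) (z : seq (option bool)) :
    seq (option bool) :=
  match pb with P1 => z | P2 => take t z end.

Definition first_stage (pb : problem) : nat :=
  match pb with P1 => 0%N | P2 => 1%N end.

Definition action2 (pb : problem) (T1 : nat) (g1 : policy1 E1)
    (g2 : policy2 E2) (y1 : nat -> E1) (y2 : nat -> E2) (t : nat) :
    option bool :=
  g2 t (obs t y2) (received pb t (messages T1 g1 y1)).

Definition tau2 (pb : problem) (T1 T2 : nat) (g1 : policy1 E1)
    (g2 : policy2 E2) (y1 : nat -> E1) (y2 : nat -> E2) : nat :=
  first_time (fun t => action2 pb T1 g1 g2 y1 y2 t != None)
    (first_stage pb) T2.

(** U^2_tau2; the default value is never used under the horizon constraint
    of O2. *)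
Definition decision (pb : problem) (T1 T2 : nat) (g1 : policy1 E1)
    (g2 : policy2 E2) (y1 : nat -> E1) (y2 : nat -> E2) : bool :=
  odflt false (action2 pb T1 g1 g2 y1 y2 (tau2 pb T1 T2 g1 g2 y1 y2)).

Definition run_cost (R : realType) (pb : problem) (T1 T2 : nat) (c1 c2 : R)
    (J : bool -> bool -> R) (g1 : policy1 E1) (g2 : policy2 E2)
    (y1 : nat -> E1) (y2 : nat -> E2) (h : bool) : R :=
  c1 * (tau1 T1 g1 y1)%:R + c2 * (tau2 pb T1 T2 g1 g2 y1 y2)%:R
  + J (decision pb T1 T2 g1 g2 y1 y2) h.

End run.

Section admissibility.
Context {d : measure_display} {E : measurableType d}.

Definition admissible1 (T1 : nat) (g1 : policy1 E) : Prop :=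
  (forall (t : nat) (m : option bool), (0 < t <= T1)%N ->
     measurable [set y : t.-tuple E | g1 t y = m]) /\
  (forall y : nat -> E,
     (forall t, (0 < t < T1)%N -> g1 t (obs t y) = None) ->
     g1 T1 (obs T1 y) <> None).

(** The message sequences that O1 can send within its horizon T1: blanks
    followed by one final message. *)
Definition possible_messages (T1 : nat) (z : seq (option bool)) : Prop :=
  exists (t : nat) (m : bool),
    (0 < t <= T1)%N /\ z = rcons (nseq t.-1 None) (Some m).

Definition admissible2 (pb : problem) (T1 T2 : nat) (g2 : policy2 E) : Prop :=
  (forall (t : nat) (z : seq (option bool)) (u : option bool),
     (first_stage pb <= t <= T2)%N ->
     measurable [set y : t.-tuple E | g2 t y z = u]) /\
  (forall (y : nat -> E) (z : seq (option bool)),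
     possible_messages T1 z ->
     (forall t, (first_stage pb <= t < T2)%N ->
        g2 t (obs t y) (received pb t z) = None) ->
     g2 T2 (obs T2 y) (received pb T2 z) <> None).

End admissibility.

Section probabilistic_model.
Context {R : realType} {d d1 d2 : measure_display}.
Context {Omega : measurableType d} {E1 : measurableType d1}
  {E2 : measurableType d2}.
Variable P : probability Omega R.

(** A counting reference measure mu on a countable space gives a discrete
    distribution, the Lebesgue measure a density in the usual sense. *)
Definition is_density (d' : measure_display) (E : measurableType d')
    (mu : {sigma_finite_measure set E -> \bar R}) (f : E -> R) : Prop :=
  [/\ measurable_fun setT f, forall y, 0 <= f y &
      (\int[mu]_y (f y)%:E = 1)%E].

(** Given H = h, all the observations Y1 t and Y2 t, t >= 1, are independent,
    with densities f1 t h with respect to mu1 t and f2 t h with respect to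
    mu2 t (subfamilies are obtained by taking some of the sets to be setT). *)
Definition observation_model (H : Omega -> bool)
    (Y1 : nat -> Omega -> E1) (Y2 : nat -> Omega -> E2)
    (mu1 : nat -> {sigma_finite_measure set E1 -> \bar R})
    (mu2 : nat -> {sigma_finite_measure set E2 -> \bar R})
    (f1 : nat -> bool -> E1 -> R) (f2 : nat -> bool -> E2 -> R) : Prop :=
  [/\ measurable_fun setT H,
      forall t, (0 < t)%N ->
        measurable_fun setT (Y1 t) /\ measurable_fun setT (Y2 t),
      forall t h, (0 < t)%N ->
        is_density (mu1 t) (f1 t h) /\ is_density (mu2 t) (f2 t h) &
      forall (h : bool) (n : nat) (A : nat -> set E1) (B : nat -> set E2),
        (forall t, measurable (A t)) -> (forall t, measurable (B t)) ->
        (P [set w | H w = h /\ forall t, (0 < t <= n)%N ->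
                      A t (Y1 t w) /\ B t (Y2 t w)] =
         P [set w | H w = h]
         * (\prod_(1 <= t < n.+1) \int[mu1 t]_(y in A t) (f1 t h y)%:E)
         * (\prod_(1 <= t < n.+1) \int[mu2 t]_(y in B t) (f2 t h y)%:E))%E].

(** [pi t] evaluated at (Y_1, ..., Y_t) is a version of the conditional
    probability of H = 0 given Y_1, ..., Y_t. *)
Definition is_belief (H : Omega -> bool) (Y : nat -> Omega -> E1) (T1 : nat)
    (pi : forall t : nat, t.-tuple E1 -> R) : Prop :=
  forall t, (0 < t <= T1)%N ->
    measurable_fun setT (pi t) /\
    forall B : set (t.-tuple E1), measurable B ->
      (\int[P]_(w in [set w | B (obs t (Y ^~ w))]) (pi t (obs t (Y ^~ w)))%:E
       = P [set w | H w = false /\ B (obs t (Y ^~ w))])%E.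

Section cost.
Variables (pb : problem) (T1 T2 : nat) (c1 c2 : R) (J : bool -> bool -> R).
Variables (H : Omega -> bool) (Y1 : nat -> Omega -> E1)
  (Y2 : nat -> Omega -> E2).

Definition random_cost (g1 : policy1 E1) (g2 : policy2 E2) (w : Omega) : R :=
  run_cost pb T1 T2 c1 c2 J g1 g2 (Y1 ^~ w) (Y2 ^~ w) (H w).

Definition expected_cost (g1 : policy1 E1) (g2 : policy2 E2) : \bar R :=
  'E_P[random_cost g1 g2].

Definition optimal1 (g1 : policy1 E1) (g2 : policy2 E2) : Prop :=
  admissible1 T1 g1 /\
  forall g, admissible1 T1 g ->
    (expected_cost g1 g2 <= expected_cost g g2)%E.

Definition send_at (t : nat) (m : bool) : policy1 E1 :=
  fun s _ => if (s < t)%N then None else Some m.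

(** With g2 fixed, and whatever h, on the event H = h it is not worse for O1
    to send the true value h at time t than the other one. *)
Definition label_consistent (g2 : policy2 E2) (t : nat) : Prop :=
  forall h : bool,
    (\int[P]_(w in [set w | H w = h]) (random_cost (send_at t h) g2 w)%:E <=
     \int[P]_(w in [set w | H w = h])
       (random_cost (send_at t (~~ h)) g2 w)%:E)%E.

End cost.
End probabilistic_model.

Section threshold_policy.
Context {R : realType} {E : Type}.

Definition threshold_policy (T1 : nat) (pi : forall t : nat, t.-tuple E -> R)
    (alpha beta delta theta : nat -> R) : policy1 E := fun k y =>
  if k == T1 then
    if pi k y <= alpha k then Some true else Some false
  else if pi k y < alpha k then None
  else if pi k y <= beta k then Some true
  else if pi k y < delta k then None
  else if pi k y <= theta k then Some false
  else None.

End threshold_policy.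

(** Exchange of the names 0 and 1 of the final messages sent at the times t
    such that [sigma t].  Which of the two messages O2 takes as evidence for
    which hypothesis is a convention of O2's policy, possibly depending on the
    sending time; renaming on both sides does not change what happens. *)
Definition rename (sigma : nat -> bool) (t : nat) (m : option bool) :
    option bool :=
  omap (addb (sigma t)) m.

Definition rename1 (E : Type) (sigma : nat -> bool) (g1 : policy1 E) :
    policy1 E :=
  fun t y => rename sigma t (g1 t y).

Definition rename2 (E : Type) (sigma : nat -> bool) (g2 : policy2 E) :
    policy2 E :=
  fun t y z =>
    g2 t y (mkseq (fun i => rename sigma i.+1 (nth None z i)) (size z)).

(* Main.v *)
Require Import Defs.
From HB Require Import structures.
From mathcomp Require Import all_boot all_order all_algebra.
From mathcomp Require Import all_classical all_reals all_analysis.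
From mathcomp Require Import measurable_realfun ring lra.

(** With the policy of O2 fixed, O1 faces an optimal stopping problem, and its
    belief is a sufficient statistic for it.

    Given H = h, the cost of sending the final message m at time t depends only
    on the observations of O2, so it is independent of what O1 has observed
    ([conditional_independence]).  Hence the expected cost of sending m at time t
    is an affine function of the belief x of O1, namely the average of its mean
    costs under the two hypotheses ([integral_stopping_cost]).  The cost of
    waiting is the expectation, over the next observation, of the optimal cost at
    the updated belief ([bayes_average]).  Bayes' rule contains a quotient, which
    disappears when costs are extended to homogeneous functions of unnormalized
    beliefs (u, v): the update is then (u f0(y), v f1(y)), and the properties of
    a [gauge] (homogeneity, superadditivity, a Lipschitz bound) are obviously
    preserved by averages over y and by minima.  So the cost of waiting is a
    concave Lipschitz function of the belief ([gauge_wait_cost]).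

    An affine function lies below a concave one on an interval.  Therefore the
    beliefs at which a given message is a best action form a closed interval
    ([superlevel_interval]), which gives at most four thresholds
    ([threshold_action_optimal]).  The interval of the message 1 comes first
    provided that under H = 1 the message 1 is not worse than 0; at the times
    when this fails, which are times at which the policy of O2 is not label
    consistent, the names of the two messages are exchanged ([swapped]).  A
    threshold policy always sends 1 at the belief alpha; if 1 should never be
    sent, alpha is a point that the law of the belief does not charge
    ([nonatom_between]).

    A backward induction ([dynamic_programming]) shows that the optimal cost of
    the stopping problem bounds the cost of every policy from below, and that a
    policy whose actions are almost surely best at the current belief attains it
    ([greedy_optimal]).  The threshold policy is such a policy. *)

Set Implicit Arguments.
Unset Strict Implicit.
Unset Printing Implicit Defensive.

Import Order.TTheory GRing.Theory Num.Theory.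

Local Open Scope classical_set_scope.
Local Open Scope ring_scope.

(** * Concave functions on the unit interval and optimal thresholds *)

Section concave_on_the_unit_interval.
Context {R : realType}.
Implicit Types phi psi : R -> R.

Definition concave01 phi := forall t x y : R,
  0 <= t <= 1 -> 0 <= x <= 1 -> 0 <= y <= 1 ->
  t * phi x + (1 - t) * phi y <= phi (t * x + (1 - t) * y).

Definition lipschitz01 phi := exists2 K : R, 0 <= K & forall x y : R,
  0 <= x <= 1 -> 0 <= y <= 1 -> phi x <= phi y + K * `|x - y|.

Definition affine (a b x : R) := x * a + (1 - x) * b.

Lemma concave01_min phi psi : concave01 phi -> concave01 psi ->
  concave01 (phi \min psi).
Proof.
move=> cphi cpsi t x y t01 x01 y01 /=; rewrite le_min; apply/andP; split.
- apply: le_trans (cphi t x y t01 x01 y01).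
  by case/andP: t01 => t0 t1; rewrite lerD// ler_wpM2l ?subr_ge0// ge_min lexx.
- apply: le_trans (cpsi t x y t01 x01 y01).
  case/andP: t01 => t0 t1.
  by rewrite lerD// ler_wpM2l ?subr_ge0// ge_min lexx orbT.
Qed.

Lemma lipschitz01_min phi psi : lipschitz01 phi -> lipschitz01 psi ->
  lipschitz01 (phi \min psi).
Proof.
move=> [K K0 lphi] [M M0 lpsi]; exists (K + M); first exact: addr_ge0.
move=> x y x01 y01 /=; rewrite -lerBlDr le_min !lerBlDr.
have := lphi x y x01 y01; have := lpsi x y x01 y01.
have := normr_ge0 (x - y) => n0.
have : Num.min (phi x) (psi x) <= phi x by rewrite ge_min lexx.
have : Num.min (phi x) (psi x) <= psi x by rewrite ge_min lexx orbT.
rewrite /= => h1 h2 h3 h4; apply/andP; split; nra.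
Qed.

Lemma concave01B_affine phi a b : concave01 phi ->
  concave01 (fun x => phi x - affine a b x).
Proof.
move=> cphi t x y t01 x01 y01; have := cphi t x y t01 x01 y01.
by rewrite /affine => h; lra.
Qed.

Lemma lipschitz01B_affine phi a b : lipschitz01 phi ->
  lipschitz01 (fun x => phi x - affine a b x).
Proof.
move=> [K K0 lphi]; exists (K + `|b - a|); first by rewrite addr_ge0.
move=> x y x01 y01; have := lphi x y x01 y01.
rewrite /affine => h; have := ler_norm ((b - a) * (x - y)).
by rewrite normrM; lra.
Qed.

Lemma concave01_affine a b : concave01 (affine a b).
Proof. by move=> t x y _ _ _; rewrite /affine; lra. Qed.

Lemma lipschitz01_affine a b : lipschitz01 (affine a b).
Proof.
exists `|a - b| => // x y _ _; have := ler_norm ((a - b) * (x - y)).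
by rewrite normrM /affine; lra.
Qed.

Lemma concave01_between phi x y z : concave01 phi ->
  0 <= x -> x <= y -> y <= z -> z <= 1 ->
  0 <= phi x -> 0 <= phi z -> 0 <= phi y.
Proof.
move=> cphi x0 xy yz z1 px pz.
have [xz|zx] := ltP x z; last first.
  by have -> : y = x by apply/le_anti; rewrite xy (le_trans yz).
pose t := (z - y) / (z - x).
have zx0 : 0 < z - x by rewrite subr_gt0.
have t01 : 0 <= t <= 1.
  by rewrite divr_ge0 ?ler_pdivrMr ?subr_ge0 ?mul1r ?(ltW xz)//= lerB.
have -> : y = t * x + (1 - t) * z.
  by rewrite /t; field; rewrite gt_eqF.
apply: le_trans (cphi t x z t01 _ _).
- by case/andP: t01 => t0 t1; rewrite addr_ge0// mulr_ge0// subr_ge0.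
- by rewrite x0 (le_trans xy)// (le_trans yz).
- by rewrite z1 andbT (le_trans x0)// (le_trans xy).
Qed.

(** The supremum and the infimum of the superlevel set belong to it by the
    Lipschitz condition, and concavity fills the gap between them. *)
Lemma superlevel_interval phi : concave01 phi -> lipschitz01 phi ->
  (exists2 x, 0 <= x <= 1 & 0 <= phi x) ->
  exists l r, [/\ 0 <= l, l <= r, r <= 1 &
    forall x, 0 <= x <= 1 -> (0 <= phi x <-> l <= x <= r)].
Proof.
move=> cphi [K K0 lphi] [x0 x001 px0].
pose S := [set x | 0 <= x <= 1 /\ 0 <= phi x].
have Sx0 : S x0 by [].
have ubS : ubound S 1 by move=> x [/andP[]].
have lbS : lbound S 0 by move=> x [/andP[]].
have hsS : has_sup S by split; [exists x0|exists 1].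
have hiS : has_inf S by split; [exists x0|exists 0].
have le_supS x : S x -> x <= sup S by move=> Sx; apply: sup_upper_bound.
have ge_infS x : S x -> inf S <= x by move=> Sx; apply: ge_inf => //; exists 0.
have sup1 : sup S <= 1 by apply: ge_sup => //; exists x0.
have inf0 : 0 <= inf S by apply: lb_le_inf => //; exists x0.
have infsup : inf S <= sup S := le_trans (ge_infS _ Sx0) (le_supS _ Sx0).
(* a Lipschitz function is nonnegative at the limits of its zero superlevel
   set *)
have closed z : 0 <= z <= 1 ->
    (forall e, 0 < e -> exists2 s, S s & `|s - z| < e) -> 0 <= phi z.
  move=> z01 az; rewrite leNgt; apply/negP => pz.
  have e0 : 0 < - phi z / (K + 1) by rewrite divr_gt0// ?oppr_gt0// ltr_wpDl.
  have [s [s01 ps]] := az _ e0; rewrite ltr_pdivlMr ?ltr_wpDl// => sz.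
  have := lphi s z s01 z01; have := normr_ge0 (s - z); nra.
exists (inf S), (sup S); split => // x x01; split => [px|/andP[ix xs]].
  by apply/andP; split; [exact: ge_infS|exact: le_supS].
have pinf : 0 <= phi (inf S).
  apply: closed; first by rewrite inf0 (le_trans infsup).
  move=> e e0; have [s Ss se] := inf_adherent e0 hiS.
  by exists s => //; rewrite ger0_norm ?subr_ge0 ?ge_infS// ltrBlDl.
have psup : 0 <= phi (sup S).
  apply: closed; first by rewrite sup1 (le_trans inf0).
  move=> e e0; have [s Ss se] := sup_adherent e0 hsS.
  exists s => //; rewrite ler0_norm ?subr_le0 ?le_supS// opprB.
  by rewrite ltrBlDl -ltrBlDr.
exact: concave01_between pinf psup.
Qed.

(** The decision of [threshold_policy] before the horizon, as a function of the
    belief alone. *)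
Definition threshold_action (al be de th x : R) : option bool :=
  if x < al then None else if x <= be then Some true
  else if x < de then None else if x <= th then Some false else None.

Definition action_cost (c1 c0 w : R) (u : option bool) : R :=
  match u with None => w | Some true => c1 | Some false => c0 end.

(** Where the concave function w lies above an affine function is an interval;
    so the beliefs at which 1 is a best action form an interval, and so do
    those at which 0 is.  As 1 is at least as good as 0 at the belief 0, the
    interval of 1 comes first.

    A threshold action always sends 1 at the point al, even if 1 is nowhere
    optimal.  The exceptional point e covers this case: it can be taken in any
    dense set, here the set of points that satisfy ok, which will be the points
    that the law of the belief does not charge. *)
Lemma threshold_action_optimal (a1 b1 a0 b0 : R) (w : R -> R)
    (ok : R -> Prop) :
  concave01 w -> lipschitz01 w -> b1 <= b0 ->
  (forall l r, l < r -> exists2 x, l < x < r & ok x) ->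
  exists al be de th e,
    [/\ [/\ 0 <= al, al <= be, be <= de, de <= th & th <= 1], ok e &
      forall x, 0 <= x <= 1 -> x <> e -> forall u,
        action_cost (affine a1 b1 x) (affine a0 b0 x) (w x)
          (threshold_action al be de th x) <=
        action_cost (affine a1 b1 x) (affine a0 b0 x) (w x) u].
Proof.
move=> cw lw b10 okd.
pose phi m x := if m then
    Num.min (w x - affine a1 b1 x) (affine a0 b0 x - affine a1 b1 x)
  else Num.min (w x - affine a0 b0 x) (affine a1 b1 x - affine a0 b0 x).
have cphi m : concave01 (phi m).
  by case: m; apply: concave01_min; apply: concave01B_affine => //;
    exact: concave01_affine.
have lphi m : lipschitz01 (phi m).
  by case: m; apply: lipschitz01_min; apply: lipschitz01B_affine => //;
    exact: lipschitz01_affine.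
have phi1E x : (0 <= phi true x) =
    (affine a1 b1 x <= w x) && (affine a1 b1 x <= affine a0 b0 x).
  by rewrite /phi le_min !subr_ge0.
have phi0E x : (0 <= phi false x) =
    (affine a0 b0 x <= w x) && (affine a0 b0 x <= affine a1 b1 x).
  by rewrite /phi le_min !subr_ge0.
have wait x : ~~ (0 <= phi true x) -> ~~ (0 <= phi false x) -> forall u,
    w x <= action_cost (affine a1 b1 x) (affine a0 b0 x) (w x) u.
  rewrite phi1E phi0E !negb_and -!ltNge => h1 h0.
  have w1 : w x <= affine a1 b1 x.
    by case/orP: h1 => [/ltW//|h1]; case/orP: h0 => h0; [lra|lra].
  have w0 : w x <= affine a0 b0 x.
    by case/orP: h1 => h1; case/orP: h0 => h0; lra.
  by case=> [[]|] /=.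
have send1 x : 0 <= phi true x -> forall u,
    affine a1 b1 x <= action_cost (affine a1 b1 x) (affine a0 b0 x) (w x) u.
  by rewrite phi1E => /andP[? ?] [[]|] /=.
have send0 x : 0 <= phi false x -> forall u,
    affine a0 b0 x <= action_cost (affine a1 b1 x) (affine a0 b0 x) (w x) u.
  by rewrite phi0E => /andP[? ?] [[]|] /=.
have [e0 e01 oke] := okd 0 1 ltr01.
have [ne1|e1] := pselect (exists2 x, 0 <= x <= 1 & 0 <= phi true x); last first.
  (* 1 is nowhere optimal: al and be collapse to an exceptional point that
     precedes the interval of 0 *)
  have n1 x : 0 <= x <= 1 -> ~~ (0 <= phi true x).
    by move=> x01; apply/negP => px; apply: e1; exists x.
  have [ne0|e0'] := pselect (exists2 x, 0 <= x <= 1 & 0 <= phi false x).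
    have [de [th [de0 deth th1 phi0P]]] :=
      superlevel_interval (cphi false) (lphi false) ne0.
    (* if 0 were optimal at the belief 0, then so would 1 *)
    have de_gt0 : 0 < de.
      rewrite lt_neqAle de0 andbT eq_sym; apply/eqP => deE.
      have p0 : 0 <= phi false 0.
        by apply/phi0P; rewrite ?lexx ?ler01// deE lexx -deE.
      have := n1 0; rewrite lexx ler01 => /(_ isT)/negP; apply.
      move: p0; rewrite phi1E phi0E /affine; lra.
    have [e /andP[e_gt0 ede] ok_e] := okd _ _ de_gt0.
    exists e, e, de, th, e; split => //; first by split => //; exact: ltW.
    move=> x x01 xe; rewrite /threshold_action.
    case: (ltP x e) => [xe'|ex].
      apply: wait; first exact: n1.
      by apply/negP => /(phi0P x x01).1 /andP[+ _]; lra.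
    case: (leP x e) => [xe'|ex'].
      by exfalso; apply: xe; apply/le_anti; rewrite xe' ex.
    case: (ltP x de) => [xde|dex].
      apply: wait; first exact: n1.
      by apply/negP => /(phi0P x x01).1 /andP[+ _]; lra.
    case: (leP x th) => [xth|thx].
      by apply: send0; apply/(phi0P x x01); rewrite dex.
    apply: wait; first exact: n1.
    by apply/negP => /(phi0P x x01).1 /andP[_]; lra.
  exists e0, e0, e0, e0, e0; split => //.
    by case/andP: e01 => ? ?; split => //; exact: ltW.
  move=> x x01 xe; rewrite /threshold_action.
  have nx : ~~ (0 <= phi false x) by apply/negP => px; apply: e0'; exists x.
  by case: (ltgtP x e0) => // _; apply: wait => //; exact: n1.
have [al [be [al0 albe be1 phi1P]]] :=
  superlevel_interval (cphi true) (lphi true) ne1.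
(* 1 is at least as good as 0 at the belief 0 and at al, hence in between *)
have before x : 0 <= x <= 1 -> x < al -> ~~ (0 <= phi false x).
  move=> x01 xal; apply/negP => p0.
  have al1 : al <= 1 by exact: le_trans be1.
  have pal : 0 <= phi true al.
    by apply/phi1P; rewrite ?al0//= lexx.
  have : 0 <= phi true x -> al <= x by move=> /(phi1P x x01).1 /andP[].
  move: pal p0; rewrite !phi1E !phi0E => /andP[_ h1] /andP[h2 h3] h4.
  have h5 : affine a1 b1 x <= affine a0 b0 x.
    have h0x : 0 <= x by case/andP: x01.
    have h0 : 0 <= affine a0 b0 0 - affine a1 b1 0 by rewrite /affine; lra.
    rewrite -subr_ge0; rewrite -subr_ge0 in h1.
    have cB := @concave01B_affine (affine a0 b0) a1 b1 (concave01_affine a0 b0).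
    exact: (concave01_between cB (lexx 0) h0x (ltW xal) al1 h0 h1).
  have : al <= x by apply: h4; rewrite h5 (le_trans h5).
  lra.
have [ne0|n0] := pselect (exists2 x, 0 <= x <= 1 & 0 <= phi false x); last first.
  have {}n0 x : 0 <= x <= 1 -> ~~ (0 <= phi false x).
    by move=> x01; apply/negP => px; apply: n0; exists x.
  exists al, be, be, be, e0; split => // x x01 _; rewrite /threshold_action.
  case: (ltP x al) => [xal|alx].
    apply: wait; last exact: n0.
    by apply/negP => /(phi1P x x01).1 /andP[+ _]; lra.
  case: (leP x be) => [xbe|bex].
    by apply: send1; apply/(phi1P x x01); rewrite alx.
  rewrite ltNge (ltW bex)/=.
  apply: wait; last exact: n0.
  by apply/negP => /(phi1P x x01).1 /andP[_]; lra.
have [de [th [de0 deth th1 phi0P]]] :=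
  superlevel_interval (cphi false) (lphi false) ne0.
(* the two intervals may overlap where 1 and 0 are equally good; the overlap is
   given to 1 *)
exists al, be, (Num.max be de), (Num.max be th), e0; split => //.
  split=> //; first by rewrite le_max lexx.
    by rewrite ge_max !le_max lexx deth orbT.
  by rewrite ge_max be1.
move=> x x01 _; rewrite /threshold_action.
case: (ltP x al) => [xal|alx].
  apply: wait; last exact: before.
  by apply/negP => /(phi1P x x01).1 /andP[+ _]; lra.
case: (leP x be) => [xbe|bex].
  by apply: send1; apply/(phi1P x x01); rewrite alx.
have n1 : ~~ (0 <= phi true x).
  by apply/negP => /(phi1P x x01).1 /andP[_]; lra.
rewrite lt_max (ltNge x be) (ltW bex)/= le_max (leNgt x be) bex/=.
case: (ltP x de) => [xde|dex].
  apply: wait => //.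
  by apply/negP => /(phi0P x x01).1 /andP[+ _]; lra.
case: (leP x th) => [xth|thx].
  by apply: send0; apply/(phi0P x x01); rewrite dex.
apply: wait => //.
by apply/negP => /(phi0P x x01).1 /andP[_]; lra.
Qed.

End concave_on_the_unit_interval.

(** * Weighted images of measures *)

Section weighted_image.
Local Open Scope ereal_scope.
Context d1 d2 (T1 : measurableType d1) (T2 : measurableType d2) (R : realType).
Variables (m : {measure set T1 -> \bar R}) (phi : T1 -> T2) (w : T1 -> R).

(** The image by phi of the measure with density w with respect to m.  The
    hypotheses are arguments so that the set function has a canonical structure
    of measure. *)
Definition weighted_image (_ : measurable_fun setT phi)
    (_ : measurable_fun setT w) (_ : forall x, (0 <= w x)%R) (A : set T2) :=
  \int[m]_(x in phi @^-1` A) (w x)%:E.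

Hypotheses (mphi : measurable_fun setT phi) (mw : measurable_fun setT w)
  (w0 : forall x, (0 <= w x)%R).

Local Notation image := (weighted_image mphi mw w0).

Let measurable_preimage (A : set T2) : measurable A ->
  measurable (phi @^-1` A).
Proof. by move=> mA; rewrite -[X in measurable X]setTI; exact: mphi. Qed.

Let image0 : image set0 = 0.
Proof. by rewrite /weighted_image preimage_set0 integral_set0. Qed.

Let image_ge0 A : 0 <= image A.
Proof. by apply: integral_ge0 => x _; rewrite lee_fin. Qed.

Let image_sigma_additive : semi_sigma_additive image.
Proof.
move=> F mF tF mUF; rewrite /weighted_image preimage_bigcup.
rewrite ge0_integral_bigcup.
- by apply: is_cvg_ereal_nneg_natsum => n _; exact: image_ge0.
- by move=> n; exact: measurable_preimage.
- by apply: measurable_funTS; exact/measurable_EFinP.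
- by move=> x _; rewrite lee_fin.
- apply/trivIsetP => /= i j _ _ ij; rewrite -preimage_setI.
  by move/trivIsetP : tF => /(_ _ _ _ _ ij) ->//; rewrite preimage_set0.
Qed.

HB.instance Definition _ := isMeasure.Build _ _ _ image
  image0 image_ge0 image_sigma_additive.

Import HBNNSimple.

Lemma integral_weighted_image (g : T2 -> \bar R) :
  measurable_fun setT g -> (forall y, 0 <= g y) ->
  \int[image]_y g y = \int[m]_x (g (phi x) * (w x)%:E).
Proof.
move=> mg g0; pose h := nnsfun_approx measurableT mg.
have mgphi n : measurable_fun setT ((h n : T2 -> R) \o phi) by exact: measurableT_comp.
have hn n : \int[image]_y (h n y)%:E = \int[m]_x ((h n (phi x))%:E * (w x)%:E).
  have mind r : measurable_fun setT (\1_(h n @^-1` [set r]) : T2 -> R).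
    exact: measurable_indic.
  rewrite integralT_nnsfun sintegralE.
  transitivity (\sum_(r \in range (h n)) \int[m]_x
      ((r * \1_(h n @^-1` [set r]) (phi x))%:E * (w x)%:E)).
    apply: eq_fsbigr => r; rewrite inE => -[y _ <-].
    have mphn : measurable (phi @^-1` (h n @^-1` [set h n y])).
      exact: measurable_preimage.
    under [RHS]eq_integral do rewrite EFinM -muleA.
    rewrite ge0_integralZl//.
    - congr (_ * _); rewrite [LHS]/= /weighted_image [LHS]integral_mkcond.
      apply: eq_integral => x _; rewrite patchE indicE.
      have -> : (x \in phi @^-1` (h n @^-1` [set h n y])) =
                (phi x \in h n @^-1` [set h n y]) by [].
      by case: (phi x \in _); rewrite ?mul1e ?mul0e.
    - apply: emeasurable_funM; apply/measurable_EFinP => //.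
      exact: (measurableT_comp (mind _)).
    - by move=> x _; rewrite -EFinM lee_fin mulr_ge0.
    - by rewrite lee_fin.
  transitivity (\int[m]_x (\sum_(r \in range (h n))
      (r * \1_(h n @^-1` [set r]) (phi x))%:E * (w x)%:E)).
    apply/esym/ge0_integral_fsum => //.
    - move=> r; apply: emeasurable_funM; apply/measurable_EFinP => //.
      apply: measurable_funM => //.
      exact: (measurableT_comp (mind _)).
    - move=> r x _; apply: mule_ge0; last by rewrite lee_fin.
      by rewrite EFinM nnfun_muleindic_ge0.
  apply: eq_integral => x _.
  rewrite -ge0_mule_fsuml => [|r]; last by rewrite EFinM nnfun_muleindic_ge0.
  by rewrite fsumEFin// -fimfunE.
transitivity (limn (fun n => \int[image]_y (h n y)%:E)).
  rewrite -monotone_convergence//.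
  - apply: eq_integral => y _; apply/esym/cvg_lim => //.
    exact: cvg_nnsfun_approx.
  - by move=> n; exact/measurable_EFinP.
  - by move=> n y _; rewrite lee_fin.
  - by move=> y _ i j ij; rewrite lee_fin; exact/lefP/nd_nnsfun_approx.
under eq_fun do rewrite hn.
rewrite -monotone_convergence//.
- apply: eq_integral => x _; apply/cvg_lim => //; apply: cvgeZr => //.
  exact: cvg_nnsfun_approx.
- move=> n; apply: emeasurable_funM; apply/measurable_EFinP => //.
  exact: mgphi.
- by move=> n x _; rewrite -EFinM lee_fin mulr_ge0.
- move=> x _ i j ij; rewrite -!EFinM lee_fin ler_wpM2r//.
  exact/lefP/nd_nnsfun_approx.
Qed.

End weighted_image.

Section equality_of_weighted_images.
Local Open Scope ereal_scope.
Context (R : realType).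

(** The tool for the changes of variables below: an identity between measures,
    which can be checked on a generating class of sets, becomes an identity
    between integrals. *)
Lemma eq_integral_weighted_image d1 d1' d2 (T1 : measurableType d1)
    (T1' : measurableType d1') (T2 : measurableType d2)
    (m : {measure set T1 -> \bar R}) (m' : {measure set T1' -> \bar R})
    (phi : T1 -> T2) (phi' : T1' -> T2) (w : T1 -> R) (w' : T1' -> R) :
  measurable_fun setT phi -> measurable_fun setT phi' ->
  measurable_fun setT w -> measurable_fun setT w' ->
  (forall x, (0 <= w x)%R) -> (forall x, (0 <= w' x)%R) ->
  (forall A, measurable A -> \int[m]_(x in phi @^-1` A) (w x)%:E =
                            \int[m']_(x in phi' @^-1` A) (w' x)%:E) ->
  forall g : T2 -> \bar R, measurable_fun setT g -> (forall y, 0 <= g y) ->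
  \int[m]_x (g (phi x) * (w x)%:E) = \int[m']_x (g (phi' x) * (w' x)%:E).
Proof.
move=> mphi mphi' mw mw' w0 w'0 ww' g mg g0.
rewrite -(integral_weighted_image m mphi mw w0)//.
rewrite -(integral_weighted_image m' mphi' mw' w'0)//.
by apply: eq_measure_integral => A mA _; exact: ww'.
Qed.

Lemma measurable_box d (E : measurableType d) n (A : nat -> set E) :
  (forall i, measurable (A i)) ->
  measurable [set z : n.-tuple E | forall i : 'I_n, A i (tnth z i)].
Proof.
move=> mA; have -> : [set z : n.-tuple E | forall i : 'I_n, A i (tnth z i)] =
    \bigcap_(i in [set: 'I_n]) (fun z => tnth z i) @^-1` A i.
  by apply/seteqP; split => z; [move=> h i _|move=> h i]; exact: h.
apply: fin_bigcap_measurable => // i _.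
by rewrite -[X in measurable X]setTI; exact: measurable_tnth.
Qed.

(** Boxes generate the sigma-algebra of tuples and are stable under
    intersection. *)
Lemma eq_measure_tuple d (E : measurableType d) n
    (m m' : {measure set (n.-tuple E) -> \bar R}) :
  m setT < +oo ->
  (forall A : nat -> set E, (forall i, measurable (A i)) ->
    m [set z | forall i : 'I_n, A i (tnth z i)] =
    m' [set z | forall i : 'I_n, A i (tnth z i)]) ->
  forall B, measurable B -> m B = m' B.
Proof.
move=> moo mm' B mB.
pose box (A : nat -> set E) := [set z : n.-tuple E |
  forall i : 'I_n, A i (tnth z i)].
pose G := [set C | exists2 A : nat -> set E,
  forall i, measurable (A i) & C = box A].
have GT : G setT.
  exists (fun=> setT) => //; rewrite /box; apply/seteqP; split => // z _ i.
apply: (measure_unique G (fun=> setT)) => //.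
- rewrite /measurable/= /g_sigma_preimage; apply/seteqP; split.
    apply: smallest_sub; first exact: smallest_sigma_algebra.
    move=> C; rewrite -bigcup_seq => -[i _] [A mA <-].
    apply: sub_sigma_algebra; exists (fun j : nat => if j == i :> nat then A else setT).
      by move=> j; case: ifP.
    rewrite setTI; apply/seteqP; split=> z; rewrite /box/=.
      by move=> Az j; case: ifPn => // /eqP/val_inj ->.
    by move=> /(_ i); rewrite eqxx.
  apply: smallest_sub; first exact: smallest_sigma_algebra.
  move=> _ [A mA ->].
  exact: measurable_box.
- move=> _ _ [A mA ->] [A' mA' ->].
  exists (fun i => A i `&` A' i); first by move=> i; exact: measurableI.
  apply/seteqP; split => z; rewrite /box/=; first by move=> [h h'] i.
  by move=> h; split => i; have [] := h i.
- by apply/seteqP; split => // z _; exists 0%N.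
- by move=> _ [A mA ->]; exact: mm'.
Qed.

(** By Fubini, the law of a real random variable charges Lebesgue-almost no
    point. *)
Lemma nonatom_between d (Omega : measurableType d) (P : probability Omega R)
    (X : Omega -> R) (l r : R) :
  measurable_fun setT X -> (l < r)%R ->
  exists2 x, (l < x < r)%R & P (X @^-1` [set x]) = 0.
Proof.
move=> mX lr; apply: contrapT => atoms.
pose leb := @lebesgue_measure R.
pose D := [set z : Omega * R | X z.1 = z.2].
have mD : measurable D.
  have -> : D = (fun z : Omega * R => X z.1 - z.2)%R @^-1` [set 0%R].
    by apply/seteqP; split => z; rewrite /D/= => /eqP;
      rewrite ?subr_eq0 => /eqP //; move=> ->; rewrite subrr.
  rewrite -[X in measurable X]setTI.
  have : measurable_fun setT (fun z : Omega * R => X z.1 - z.2)%R.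
    apply: measurable_funB => //; exact: measurableT_comp.
  by apply.
have mI : measurable_fun setT (fun z : Omega * R => (\1_D z)%:E : \bar R).
  by apply/measurable_EFinP; exact: measurable_indic.
have I0 z : 0 <= (\1_D z)%:E :> \bar R by rewrite lee_fin.
have := fubini_tonelli (m1 := P) (m2 := leb) _ mI I0.
under eq_integral => w _.
  rewrite (_ : (fun y => _) = (fun y => (\1_[set X w] y)%:E)); last first.
    apply/funext => y; rewrite !indicE.
    suff -> : ((w, y) \in D) = (y \in [set X w]) by [].
    by apply/idP/idP; rewrite !inE /D/=.
  rewrite integral_indic//= setIT lebesgue_measure_set1.
  over.
rewrite integral0 => /esym intX0.
have PE y : \int[P]_w (\1_D (w, y))%:E = P (X @^-1` [set y]).
  have mXy : measurable (X @^-1` [set y]).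
    by rewrite -[X in measurable X]setTI; exact: mX.
  transitivity (\int[P]_w (\1_(X @^-1` [set y]) w)%:E); last first.
    by rewrite integral_indic// setIT.
  apply: eq_integral => w _; rewrite !indicE.
  suff -> : ((w, y) \in D) = (w \in X @^-1` [set y]) by [].
  by apply/idP/idP; rewrite !inE.
have mPX := measurable_fun_fubini_tonelli_G (m1 := P) _ mI I0.
have [N [mN N0 XN]] : ae_eq leb setT (fun y => \int[P]_w (\1_D (w, y))%:E) (cst 0).
  apply/ae_eq_integral_abs => //.
  rewrite -[RHS]intX0; apply: eq_integral => y _.
  by rewrite gee0_abs// integral_ge0.
have : leb `]l, r[%classic <= leb N.
  apply: le_measure; rewrite ?inE//= => x /=; rewrite in_itv/= => lxr.
  apply: XN => /= /(_ Logic.I); rewrite PE => Px0.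
  by apply: atoms; exists x.
rewrite [X in _ <= X]N0 /leb lebesgue_measure_itv/= lte_fin lr -EFinB lee_fin.
by rewrite subr_le0 leNgt lr.
Qed.

End equality_of_weighted_images.

(** * Gauges: concave homogeneous functions of an unnormalized belief *)

Section gauges.
Context {R : realType}.
Implicit Types V : R -> R -> R.

(** The optimal costs are seen as functions of an unnormalized belief: u and v
    are the weights of the hypotheses 0 and 1.  In these coordinates Bayes'
    rule multiplies u and v by the two likelihoods, without any division, and
    concavity in the belief becomes superadditivity for homogeneous
    functions. *)
Record gauge V : Prop := Gauge {
  gauge_measurable : measurable_fun setT (fun p : R * R => V p.1 p.2);
  gauge_ge0 : forall u v : R, 0 <= V u v;
  gauge_homogeneous : forall c u v : R, 0 <= c -> 0 <= u -> 0 <= v ->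
    V (c * u) (c * v) = c * V u v;
  gauge_superadditive : forall u v u' v' : R,
    0 <= u -> 0 <= v -> 0 <= u' -> 0 <= v' ->
    V u v + V u' v' <= V (u + u') (v + v');
  gauge_lipschitz : exists2 K : R, 0 <= K & forall u v h k : R,
    0 <= u -> 0 <= v -> 0 <= h -> 0 <= k ->
    V (u + h) (v + k) <= V u v + K * (h + k) }.

Lemma gauge_monotone V : gauge V -> forall u v u' v' : R,
  0 <= u -> 0 <= v -> u <= u' -> v <= v' -> V u v <= V u' v'.
Proof.
move=> gV u v u' v' u0 v0 uu' vv'.
have := gauge_superadditive gV u0 v0 (_ : 0 <= u' - u) (_ : 0 <= v' - v).
rewrite !subr_ge0 => /(_ uu' vv'); rewrite !subrKC.
have := gauge_ge0 gV (u' - u) (v' - v); lra.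
Qed.

Lemma gauge_bound V : gauge V -> exists2 K : R, 0 <= K &
  forall u v : R, 0 <= u -> 0 <= v -> V u v <= K * (u + v).
Proof.
move=> gV; have [K K0 lV] := gauge_lipschitz gV; exists K => // u v u0 v0.
have := lV 0 0 u v (lexx 0) (lexx 0) u0 v0.
by rewrite -(mul0r 0) (gauge_homogeneous gV)// !mul0r !add0r.
Qed.

(** The absolute values make the function nonnegative on the whole plane. *)
Lemma gauge_linear (a b : R) : 0 <= a -> 0 <= b ->
  gauge (fun u v => a * `|u| + b * `|v|).
Proof.
move=> a0 b0; split.
- by apply: measurable_funD; apply: measurable_funM => //;
    apply: measurableT_comp => //; exact: measurable_normr.
- by move=> u v; rewrite addr_ge0// mulr_ge0.
- by move=> c u v c0 u0 v0; rewrite !normrM (ger0_norm c0); lra.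
- by move=> u v u' v' u0 v0 u'0 v'0; rewrite !ger0_norm ?addr_ge0//; lra.
- exists (a + b); first exact: addr_ge0.
  move=> u v h k u0 v0 h0 k0; rewrite !ger0_norm ?addr_ge0//.
  by have := mulr_ge0 a0 k0; have := mulr_ge0 b0 h0; lra.
Qed.

Lemma gauge_min V V' : gauge V -> gauge V' ->
  gauge (fun u v => Num.min (V u v) (V' u v)).
Proof.
move=> gV gV'; split.
- by apply: measurable_minr; exact: gauge_measurable.
- by move=> u v; rewrite le_min !gauge_ge0.
- move=> c u v c0 u0 v0.
  by rewrite (gauge_homogeneous gV)// (gauge_homogeneous gV')// minr_pMr.
- move=> u v u' v' u0 v0 u'0 v'0.
  have := gauge_superadditive gV u0 v0 u'0 v'0.
  have := gauge_superadditive gV' u0 v0 u'0 v'0.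
  by rewrite le_min !minEle; do 2 case: ifPn; lra.
- have [K K0 lV] := gauge_lipschitz gV; have [K' K'0 lV'] := gauge_lipschitz gV'.
  exists (K + K'); first exact: addr_ge0.
  move=> u v h k u0 v0 h0 k0.
  have := lV u v h k u0 v0 h0 k0; have := lV' u v h k u0 v0 h0 k0.
  have := mulr_ge0 K0 (addr_ge0 h0 k0); have := mulr_ge0 K'0 (addr_ge0 h0 k0).
  by move=> ? ? ? ?; rewrite !minEle; do 2 case: ifPn; rewrite -?ltNge; lra.
Qed.

Lemma gauge_concave01 V : gauge V -> concave01 (fun x => V x (1 - x)).
Proof.
move=> gV t x y /andP[t0 t1] /andP[x0 x1] /andP[y0 y1].
have t1' : 0 <= 1 - t by rewrite subr_ge0.
have x1' : 0 <= 1 - x by rewrite subr_ge0.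
have y1' : 0 <= 1 - y by rewrite subr_ge0.
rewrite -!(gauge_homogeneous gV)//.
have -> : 1 - (t * x + (1 - t) * y) = t * (1 - x) + (1 - t) * (1 - y) by ring.
by apply: (gauge_superadditive gV); exact: mulr_ge0.
Qed.

Lemma gauge_lipschitz01 V : gauge V -> lipschitz01 (fun x => V x (1 - x)).
Proof.
move=> gV; have [K K0 lV] := gauge_lipschitz gV; exists K => // x y.
move=> /andP[x0 x1] /andP[y0 y1].
have [xy|yx] := leP x y.
- have := lV x (1 - y) 0 (y - x) x0 _ (lexx 0).
  rewrite !subr_ge0 addr0 add0r => /(_ y1 xy).
  have -> : 1 - y + (y - x) = 1 - x by ring.
  have := @gauge_monotone V gV x (1 - y) y (1 - y) x0 _ xy (lexx _).
  rewrite subr_ge0 => /(_ y1).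
  by rewrite ler0_norm ?subr_le0// opprB; lra.
- have := lV y (1 - x) (x - y) 0 y0.
  rewrite !subr_ge0 addr0 addr0 subrKC => /(_ x1 (ltW yx) (lexx _)).
  have := @gauge_monotone V gV y (1 - x) y (1 - y) y0 _ (lexx _).
  rewrite subr_ge0 => /(_ x1); rewrite lerB ?(ltW yx)// => /(_ isT).
  by rewrite gtr0_norm ?subr_gt0//; lra.
Qed.

End gauges.

(** The expectation of V after one more observation, when the observation has
    density f0 under the hypothesis 0 and f1 under the hypothesis 1. *)
Definition average {R : realType} d (E : measurableType d)
    (mu : {sigma_finite_measure set E -> \bar R}) (f0 f1 : E -> R)
    (V : R -> R -> R) (u v : R) : R :=
  fine (\int[mu]_y (V (u * f0 y) (v * f1 y))%:E).

Section gauge_average.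
Context {R : realType} d (E : measurableType d).
Variables (mu : {sigma_finite_measure set E -> \bar R}) (f0 f1 : E -> R).
Hypotheses (df0 : is_density mu f0) (df1 : is_density mu f1).

Variable V : R -> R -> R.
Hypothesis gV : gauge V.

Let mf0 : measurable_fun setT f0. Proof. by have [] := df0. Qed.
Let mf1 : measurable_fun setT f1. Proof. by have [] := df1. Qed.
Let f00 y : 0 <= f0 y. Proof. by have [] := df0. Qed.
Let f10 y : 0 <= f1 y. Proof. by have [] := df1. Qed.

Lemma measurable_gauge_density (u v : R) :
  measurable_fun setT (fun y => V (u * f0 y) (v * f1 y)).
Proof.
apply: (measurableT_comp (gauge_measurable gV)
  (g := fun y => (u * f0 y, v * f1 y))).
by apply: measurable_fun_pair; exact: measurable_funM.
Qed.

Let integral_linear (h k : R) : 0 <= h -> 0 <= k ->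
  (\int[mu]_y (h * f0 y + k * f1 y)%:E = (h + k)%:E)%E.
Proof.
move=> h0 k0; under eq_integral do rewrite EFinD !EFinM.
rewrite ge0_integralD//=.
- rewrite !ge0_integralZl//.
  + by have [_ _ ->] := df0; have [_ _ ->] := df1; rewrite !mule1.
  + exact/measurable_EFinP.
  + by move=> y _; rewrite lee_fin.
  + exact/measurable_EFinP.
  + by move=> y _; rewrite lee_fin.
- by move=> y _; rewrite -EFinM lee_fin mulr_ge0.
- by apply/measurable_EFinP; exact: measurable_funM.
- by move=> y _; rewrite -EFinM lee_fin mulr_ge0.
- by apply/measurable_EFinP; exact: measurable_funM.
Qed.

Lemma averageE (u v : R) : 0 <= u -> 0 <= v ->
  (\int[mu]_y (V (u * f0 y) (v * f1 y))%:E = (average mu f0 f1 V u v)%:E)%E.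
Proof.
move=> u0 v0; rewrite /average fineK//.
rewrite ge0_fin_numE; last by apply: integral_ge0 => y _;
  rewrite lee_fin gauge_ge0.
have [K K0 bV] := gauge_bound gV.
apply: (@le_lt_trans _ _ (\int[mu]_y (K%:E * (u * f0 y + v * f1 y)%:E))%E).
  apply: ge0_le_integral => //.
  - by move=> y _; rewrite lee_fin gauge_ge0.
  - exact/measurable_EFinP/measurable_gauge_density.
  - apply/measurable_EFinP; apply: measurable_funM => //.
    by apply: measurable_funD; exact: measurable_funM.
  - by move=> y _; rewrite -EFinM lee_fin; apply: bV; rewrite mulr_ge0.
rewrite ge0_integralZl//.
- by rewrite integral_linear// -EFinM ltry.
- by apply/measurable_EFinP; apply: measurable_funD; exact: measurable_funM.
- by move=> y _; rewrite lee_fin addr_ge0// mulr_ge0.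
Qed.

Lemma gauge_average : gauge (average mu f0 f1 V).
Proof.
have mV u v : measurable_fun setT (fun y => (V (u * f0 y) (v * f1 y))%:E).
  exact/measurable_EFinP/measurable_gauge_density.
have V0 u v : forall y, [set: E] y -> (0 <= (V (u * f0 y) (v * f1 y))%:E)%E.
  by move=> y _; rewrite lee_fin gauge_ge0.
split.
- apply: (@measurableT_comp _ _ _ _ _ _ fine) => //.
  pose F (z : (R * R) * E) := (V (z.1.1 * f0 z.2) (z.1.2 * f1 z.2))%:E.
  have mF : measurable_fun setT F.
    apply/measurable_EFinP; apply: (measurableT_comp (gauge_measurable gV)
      (g := fun z : (R * R) * E => (z.1.1 * f0 z.2, z.1.2 * f1 z.2))).
    by apply: measurable_fun_pair; apply: measurable_funM => //;
      do ? apply: measurableT_comp => //.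
  apply: (measurable_fun_fubini_tonelli_F (m2 := mu) F mF) => z.
  by rewrite lee_fin gauge_ge0.
- by move=> u v; apply/fine_ge0/integral_ge0; exact: V0.
- move=> c u v c0 u0 v0; rewrite /average.
  under eq_integral do rewrite -!mulrA gauge_homogeneous ?mulr_ge0// EFinM.
  rewrite ge0_integralZl//; last exact: V0.
  by rewrite averageE// -EFinM.
- move=> u v u' v' u0 v0 u'0 v'0.
  rewrite -lee_fin EFinD -!averageE ?addr_ge0// -ge0_integralD//;
    [|exact: V0..].
  apply: ge0_le_integral => //.
  + by move=> y _; rewrite adde_ge0// V0.
  + exact: emeasurable_funD.
  + move=> y _; rewrite -EFinD lee_fin !mulrDl.
    by apply: (gauge_superadditive gV); exact: mulr_ge0.
- have [K K0 lV] := gauge_lipschitz gV; exists K => // u v h k u0 v0 h0 k0.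
  have mhk : measurable_fun setT (fun y => (h * f0 y + k * f1 y)%:E).
    by apply/measurable_EFinP; apply: measurable_funD; exact: measurable_funM.
  have hk0 y : [set: E] y -> (0 <= (h * f0 y + k * f1 y)%:E)%E.
    by move=> _; rewrite lee_fin addr_ge0// mulr_ge0.
  rewrite -lee_fin EFinD EFinM -!averageE ?addr_ge0//.
  rewrite -(integral_linear h0 k0) -ge0_integralZl//.
  rewrite -ge0_integralD//; [|exact: V0|..].
  + apply: ge0_le_integral => //.
    * exact: V0.
    * by apply: emeasurable_funD => //; exact: emeasurable_funM.
    * move=> y _; rewrite -EFinM -EFinD lee_fin !mulrDl.
      by apply: lV; exact: mulr_ge0.
  + by move=> y _; rewrite mule_ge0// hk0.
  + exact: emeasurable_funM.
Qed.

End gauge_average.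

Section rectangles.
Local Open Scope ereal_scope.
Context (R : realType) d1 d2 (T1 : measurableType d1) (T2 : measurableType d2).

Lemma eq_measure_rectangle (m m' : {measure set (T1 * T2) -> \bar R}) :
  m setT < +oo ->
  (forall A B, measurable A -> measurable B -> m (A `*` B) = m' (A `*` B)) ->
  forall C, measurable C -> m C = m' C.
Proof.
move=> moo mm' C mC.
pose G := [set C : set (T1 * T2) |
  exists2 A, measurable A & exists2 B, measurable B & A `*` B = C].
apply: (measure_unique G (fun=> setT)) => //.
- exact: measurable_prod_measurableType.
- move=> _ _ [A mA [B mB <-]] [A' mA' [B' mB' <-]].
  exists (A `&` A'); first exact: measurableI.
  by exists (B `&` B'); [exact: measurableI|rewrite setXI].
- by move=> _; exists setT => //; exists setT => //; rewrite setXTT.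
- by apply/seteqP; split => // z _; exists 0%N.
- by move=> _ [A mA [B mB <-]]; exact: mm'.
Qed.

End rectangles.

(** * Posterior probabilities *)

Section posterior.
Context {R : realType} d d' (Omega : measurableType d) (T : measurableType d').
Variable P : probability Omega R.
Implicit Types (D : set Omega) (X : Omega -> T) (q : T -> R).

(** q evaluated at X is a version of the conditional probability of D given
    X. *)
Definition posterior D X q : Prop :=
  measurable_fun setT q /\ forall B, measurable B ->
    (\int[P]_(w in X @^-1` B) (q (X w))%:E = P (D `&` X @^-1` B))%E.

Lemma preimage_measurable X B : measurable_fun setT X -> measurable B ->
  measurable (X @^-1` B).
Proof. by move=> mX mB; rewrite -[X in measurable X]setTI; exact: mX. Qed.

Let null_set_positive (N : set Omega) (f : Omega -> R) : measurable N ->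
  measurable_fun setT f -> (forall w, N w -> 0 < f w) ->
  (\int[P]_(w in N) (f w)%:E <= 0)%E -> P N = 0%E.
Proof.
move=> mN mf f0 If0.
have mEf : measurable_fun N (fun w => (f w)%:E).
  by apply: measurable_funTS; exact/measurable_EFinP.
have [M [mM M0 NM]] : ae_eq P N (fun w => (f w)%:E) (cst 0%E).
  apply/ae_eq_integral_abs => //.
  apply/le_anti; rewrite integral_ge0// andbT.
  rewrite (eq_integral (fun w => (f w)%:E))//= => w /set_mem Nw.
  by rewrite ger0_norm// ltW// f0.
apply: (subset_measure0 _ _ _ M0) => // w Nw; apply: NM => /= /(_ Nw).
by move=> [fw0]; have := f0 _ Nw; rewrite fw0 ltxx.
Qed.

(** On the event that q is negative (or exceeds 1), unless it is null, the
    integral of q is negative (or exceeds the probability of the event); but this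
    integral is the probability of a smaller event. *)
Lemma posterior_ae01 D X q : measurable D -> measurable_fun setT X ->
  posterior D X q -> {ae P, forall w, 0 <= q (X w) <= 1}.
Proof.
move=> mD mX [mq qE].
have mqX : measurable_fun setT (q \o X) by exact: measurableT_comp.
pose N0 := X @^-1` (q @^-1` `]-oo, 0[%classic).
pose N1 := X @^-1` (q @^-1` `]1, +oo[%classic).
have mN0' : measurable (q @^-1` `]-oo, 0[%classic).
  by rewrite -[X in measurable X]setTI; exact: mq.
have mN1' : measurable (q @^-1` `]1, +oo[%classic).
  by rewrite -[X in measurable X]setTI; exact: mq.
have mN0 : measurable N0 by exact: preimage_measurable.
have mN1 : measurable N1 by exact: preimage_measurable.
have PN0 : P N0 = 0%E.
  apply: (@null_set_positive _ (fun w => - q (X w))) => //.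
  - exact: measurableT_comp.
  - by move=> w; rewrite /N0/= in_itv/= oppr_gt0.
  - under eq_integral do rewrite EFinN.
    rewrite -leeN2 oppe0 -integral_ge0N.
      under eq_integral do rewrite oppeK.
      by rewrite qE.
    by move=> w; rewrite /N0/= in_itv/= => q0; rewrite lee_fin oppr_ge0 ltW.
have PN1 : P N1 = 0%E.
  apply: (@null_set_positive _ (fun w => q (X w) - 1)) => //.
  - exact: measurable_funB.
  - by move=> w; rewrite /N1/= in_itv/= andbT subr_gt0.
  - have := qE _ mN1'; rewrite -/N1.
    have -> : (\int[P]_(w in N1) (q (X w))%:E =
        \int[P]_(w in N1) ((q (X w) - 1)%:E + (1)%:E))%E.
      by apply: eq_integral => w _; rewrite -EFinD subrK.
    rewrite ge0_integralD//.
    + rewrite integral_cst// mul1e => qP.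
      have : (\int[P]_(w in N1) (q (X w) - 1)%:E + P N1 <= 0 + P N1)%E.
        by rewrite qP add0e measureIr.
      by rewrite leeD2rE// fin_num_measure.
    + by move=> w; rewrite /N1/= in_itv/= andbT lee_fin subr_ge0 => /ltW.
    + apply: measurable_funTS; apply/measurable_EFinP.
      exact: measurable_funB.
exists (N0 `|` N1); split; first exact: measurableU.
  by rewrite [LHS]null_set_setU.
move=> w /= /negP; rewrite negb_and -!ltNge => /orP[q0|q1]; [left|right].
  by rewrite /N0/= in_itv/=.
by rewrite /N1/= in_itv/= q1.
Qed.

(** A version of a posterior probability may leave the unit interval on a null
    set; clamping it there gives a version that is bounded everywhere. *)
Definition clamp (x : R) : R := Num.max 0 (Num.min 1 x).

Lemma clamp01 x : 0 <= clamp x <= 1.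
Proof. by rewrite /clamp le_max lexx/= ge_max ler01 ge_min lexx. Qed.

Lemma clamp_id x : 0 <= x <= 1 -> clamp x = x.
Proof. by move=> /andP[x0 x1]; rewrite /clamp min_r// max_r. Qed.

Lemma posterior_clamp D X q : measurable D -> measurable_fun setT X ->
  posterior D X q -> posterior D X (clamp \o q).
Proof.
move=> mD mX pq; have [mq qE] := pq.
have mcq : measurable_fun setT (clamp \o q).
  by apply: measurable_maxr => //; exact: measurable_minr.
split=> // B mB; rewrite -qE//; apply: ae_eq_integral.
- exact: preimage_measurable.
- apply: measurable_funTS; apply/measurable_EFinP.
  exact: (measurableT_comp mcq mX).
- apply: measurable_funTS; apply/measurable_EFinP.
  exact: (measurableT_comp mq mX).
- have := posterior_ae01 mD mX pq; apply: filterS => w qw01 _ /=.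
  by rewrite clamp_id.
Qed.

Lemma posterior_setC D X q : measurable D -> measurable_fun setT X ->
  (forall x, 0 <= q x <= 1) ->
  posterior D X q -> posterior (~` D) X (fun x => 1 - q x).
Proof.
move=> mD mX q01 [mq qE]; split; first exact: measurable_funB.
move=> B mB; have mXB : measurable (X @^-1` B) by exact: preimage_measurable.
have mqX : measurable_fun setT (q \o X) by exact: measurableT_comp.
have : (\int[P]_(w in X @^-1` B) ((1 - q (X w))%:E + (q (X w))%:E) =
    P (~` D `&` X @^-1` B) + P (D `&` X @^-1` B))%E.
  under eq_integral do rewrite -EFinD subrK.
  rewrite integral_cst// mul1e -measureU.
  - by rewrite -setIUl setUC setUv setTI.
  - exact/measurableI/mXB/measurableC.
  - exact: measurableI.
  - by rewrite setIACA setICl set0I.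
rewrite ge0_integralD//.
- rewrite qE// => /(congr1 (fun z => z - P (D `&` X @^-1` B)))%E.
  by rewrite !addeK// fin_num_measure//; exact: measurableI.
- by move=> w _; rewrite lee_fin subr_ge0; case/andP: (q01 (X w)).
- by apply: measurable_funTS; apply/measurable_EFinP; exact: measurable_funB.
- by move=> w _; rewrite lee_fin; case/andP: (q01 (X w)).
- by apply: measurable_funTS; exact/measurable_EFinP.
Qed.

Lemma integral_posterior D X q : measurable D -> measurable_fun setT X ->
  (forall x, 0 <= q x) -> posterior D X q ->
  forall g : T -> \bar R, measurable_fun setT g -> (forall x, (0 <= g x)%E) ->
  (\int[P]_w (g (X w) * (\1_D w)%:E) = \int[P]_w (g (X w) * (q (X w))%:E))%E.
Proof.
move=> mD mX q0 [mq qE] g mg g0.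
apply: (eq_integral_weighted_image (phi := X) (phi' := X)) => //.
- by rewrite -/(q \o X); exact: measurableT_comp.
- by move=> A mA; rewrite qE// integral_indic//; exact: preimage_measurable.
Qed.

End posterior.

(** * Bayes' rule for one more observation *)

Section bayes.
Context {R : realType} d dT dE (Omega : measurableType d)
  (T : measurableType dT) (E : measurableType dE).
Variables (P : probability Omega R)
  (mu : {sigma_finite_measure set E -> \bar R}) (X : Omega -> T)
  (Z : Omega -> E).
Hypotheses (mX : measurable_fun setT X) (mZ : measurable_fun setT Z).

(** Given D and X, the random variable Z has density f with respect to mu. *)
Definition next_observation (D : set Omega) (f : E -> R) : Prop :=
  forall A C, measurable A -> measurable C ->
    (P (D `&` X @^-1` A `&` Z @^-1` C) =
     P (D `&` X @^-1` A) * \int[mu]_(y in C) (f y)%:E)%E.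

Let XZ w := (X w, Z w).
Let Xid (z : Omega * E) := (X z.1, z.2).

Let mXZ : measurable_fun setT XZ.
Proof. exact: measurable_fun_pair. Qed.

Let mXid : measurable_fun setT Xid.
Proof. by apply: measurable_fun_pair => //; exact: measurableT_comp. Qed.

(** Both sides integrate G against a weighted image on the product space, and
    the two images agree on rectangles. *)
Let integral_joint_indic (D : set Omega) (f : E -> R) : measurable D ->
  is_density mu f -> next_observation D f ->
  forall G : T * E -> \bar R, measurable_fun setT G ->
    (forall z, (0 <= G z)%E) ->
  (\int[P]_w (G (XZ w) * (\1_D w)%:E) =
   \int[P \x mu]_z (G (Xid z) * (\1_D z.1 * f z.2)%:E))%E.
Proof.
move=> mD [mf f0 If] indep G mG G0.
have m1D : measurable_fun setT (\1_D : Omega -> R) by exact: measurable_indic.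
have mw : measurable_fun setT (fun z : Omega * E => \1_D z.1 * f z.2 : R).
  by apply: measurable_funM; exact: measurableT_comp.
have D0 w : 0 <= \1_D w :> R by [].
have w0 z : 0 <= \1_D z.1 * f z.2 :> R by exact: mulr_ge0.
apply: (eq_integral_weighted_image (phi := XZ) (phi' := Xid)) => // B mB.
apply: (@eq_measure_rectangle _ _ _ _ _ (weighted_image P mXZ m1D D0)
  (weighted_image (P \x mu)%E mXid mw w0)) => // [|{}B C {}mB mC].
  rewrite /= /weighted_image preimage_setT integral_indic// setIT.
  by rewrite (le_lt_trans (probability_le1 _ _))// ltry.
rewrite /= /weighted_image.
have mXB : measurable (X @^-1` B) by exact: preimage_measurable.
have mDX : measurable (D `&` X @^-1` B) by exact: measurableI.
transitivity (P (D `&` X @^-1` B `&` Z @^-1` C)).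
  rewrite integral_indic//; first by rewrite setIA.
  exact: (preimage_measurable mXZ (measurableX mB mC)).
rewrite indep// integral_mkcond/=.
pose F (z : Omega * E) :=
  ((\1_(D `&` X @^-1` B) z.1)%:E * (f z.2 * \1_C z.2)%:E : \bar R)%E.
have mfC : measurable_fun setT (fun y => f y * \1_C y).
  by apply: measurable_funM => //; exact: measurable_indic.
have mF : measurable_fun setT F.
  apply: emeasurable_funM; apply/measurable_EFinP.
    apply: (@measurableT_comp _ _ _ _ _ _ (\1_(D `&` X @^-1` B) : _ -> R)) => //.
  exact: (measurableT_comp mfC).
have F0 z : (0 <= F z)%E by rewrite mule_ge0 ?lee_fin// mulr_ge0.
transitivity (\int[P \x mu]_z F z)%E; last first.
  apply: eq_integral => z _; rewrite patchE /F -EFinM.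
  have -> : (z \in Xid @^-1` (B `*` C)) = (X z.1 \in B) && (z.2 \in C).
    by apply/idP/andP; rewrite !inE.
  rewrite !indicE in_setI.
  have -> : (z.1 \in X @^-1` B) = (X z.1 \in B) by [].
  by case: (_ \in D); case: (_ \in B); case: (_ \in C);
    rewrite ?(mul0r, mulr0, mul1r, mulr1).
rewrite fubini_tonelli1//=; transitivity (\int[P]_w
  ((\1_(D `&` X @^-1` B) w)%:E * \int[mu]_(y in C) (f y)%:E))%E.
  rewrite ge0_integralZr//.
  - by rewrite integral_indic// setIT.
  - exact/measurable_EFinP/measurable_indic.
  - by apply: integral_ge0 => y _; rewrite lee_fin.
apply: eq_integral => w _.
transitivity (\int[mu]_y
  ((\1_(D `&` X @^-1` B) w)%:E * (f y * \1_C y)%:E))%E => //.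
rewrite ge0_integralZl//.
- congr (_ * _)%E; rewrite [LHS]integral_mkcond; apply: eq_integral => y _.
  by rewrite patchE indicE; case: (y \in C); rewrite ?mulr1 ?mulr0.
- exact/measurable_EFinP.
- by move=> y _; rewrite lee_fin mulr_ge0.
Qed.

Lemma integral_joint (D : set Omega) (f : E -> R) (q : T -> R) : measurable D ->
  is_density mu f -> next_observation D f ->
  posterior P D X q -> (forall x, 0 <= q x) ->
  forall G : T * E -> \bar R, measurable_fun setT G ->
    (forall z, (0 <= G z)%E) ->
  (\int[P]_w (G (X w, Z w) * (\1_D w)%:E) =
   \int[P \x mu]_z (G (X z.1, z.2) * (q (X z.1) * f z.2)%:E))%E.
Proof.
move=> mD df indep pq q0 G mG G0; have [mf f0 If] := df; have [mq _] := pq.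
rewrite (integral_joint_indic mD df indep)//.
pose k x := (\int[mu]_y (G (x, y) * (f y)%:E))%E.
have mGf : measurable_fun setT (fun z : T * E => (G z * (f z.2)%:E)%E).
  apply: emeasurable_funM => //; apply/measurable_EFinP.
  exact: measurableT_comp.
have Gf0 z : (0 <= G z * (f z.2)%:E)%E by rewrite mule_ge0// lee_fin.
have mk : measurable_fun setT k := measurable_fun_fubini_tonelli_F _ mGf Gf0.
have k0 x : (0 <= k x)%E.
  by apply: integral_ge0 => y _; exact: (Gf0 (x, y)).
have inner (a : Omega -> R) : measurable_fun setT a -> (forall w, 0 <= a w) ->
    (\int[P \x mu]_z (G (Xid z) * (a z.1 * f z.2)%:E) =
     \int[P]_w (k (X w) * (a w)%:E))%E.
  move=> ma a0; rewrite fubini_tonelli1/=.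
  - apply: eq_integral => w _; rewrite /fubini_F/= /k -ge0_integralZr//.
    + by apply: eq_integral => y _; rewrite mulrC EFinM muleA.
    + apply: emeasurable_funM; last exact/measurable_EFinP.
      exact: (measurableT_comp mG).
    + by move: (a0 w); rewrite -lee_fin.
  - apply: emeasurable_funM; first exact: (measurableT_comp mG mXid).
    by apply/measurable_EFinP; apply: measurable_funM; exact: measurableT_comp.
  - by move=> z; rewrite mule_ge0// lee_fin mulr_ge0.
have m1D : measurable_fun setT (\1_D : Omega -> R) by exact: measurable_indic.
rewrite (inner _ m1D (fun w => ler0n R _)).
rewrite (inner (q \o X) (measurableT_comp mq mX) (fun w => q0 (X w))).
exact: integral_posterior.
Qed.


(** The martingale identity of dynamic programming.  With respect to the image
    M of P x mu, the law of (X, Z) restricted to D has the density a = q f0,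
    and its restriction to the complement the density b = (1 - q) f1.  So
    a = q' (a + b) and b = (1 - q') (a + b) hold M-almost everywhere, which is
    Bayes' rule.  By homogeneity V a b = (a + b) V q' (1 - q'), and a + b is the
    density of the law of (X, Z). *)
Lemma bayes_average (D : set Omega) (f0 f1 : E -> R) (q : T -> R)
    (q' : T * E -> R) (V : R -> R -> R) (S : set T) :
  measurable D -> is_density mu f0 -> is_density mu f1 ->
  next_observation D f0 -> next_observation (~` D) f1 ->
  posterior P D X q -> (forall x, 0 <= q x <= 1) ->
  posterior P D (fun w => (X w, Z w)) q' -> (forall z, 0 <= q' z <= 1) ->
  gauge V -> measurable S ->
  (\int[P]_(w in X @^-1` S) (V (q' (X w, Z w)) (1 - q' (X w, Z w)))%:E =
   \int[P]_(w in X @^-1` S)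
     (average mu f0 f1 V (q (X w)) (1 - q (X w)))%:E)%E.
Proof.
move=> mD df0 df1 indep0 indep1 pq q01 pq' q'01 gV mS.
have mDC : measurable (~` D) by exact: measurableC.
have pqC := posterior_setC mD mX q01 pq.
have pq'C := posterior_setC mD mXZ q'01 pq'.
have q0 x : 0 <= q x by case/andP: (q01 x).
have qC0 x : 0 <= 1 - q x by rewrite subr_ge0; case/andP: (q01 x).
have q'0 z : 0 <= q' z by case/andP: (q'01 z).
have q'C0 z : 0 <= 1 - q' z by rewrite subr_ge0; case/andP: (q'01 z).
have [mq _] := pq; have [mq' _] := pq'; have [mqC _] := pqC.
have [mq'C _] := pq'C.
have [mf0 f00 _] := df0; have [mf1 f10 _] := df1.
have m1 : measurable_fun setT (fun _ : Omega * E => 1 : R) by [].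
have ge01 (z : Omega * E) : 0 <= 1 :> R by [].
pose M := weighted_image (P \x mu)%E mXid m1 ge01.
have intM G : measurable_fun setT G -> (forall z, (0 <= G z)%E) ->
    (\int[M]_z G z = \int[P \x mu]_z G (X z.1, z.2))%E.
  move=> mG G0; rewrite integral_weighted_image//.
  by apply: eq_integral => z _; rewrite mule1.
pose a (z : T * E) := q z.1 * f0 z.2.
pose b (z : T * E) := (1 - q z.1) * f1 z.2.
have ma : measurable_fun setT a.
  by apply: measurable_funM; [exact: (measurableT_comp mq)
    |exact: (measurableT_comp mf0)].
have mb : measurable_fun setT b.
  by apply: measurable_funM; [exact: (measurableT_comp mqC)
    |exact: (measurableT_comp mf1)].
have a0 z : 0 <= a z by exact: mulr_ge0.
have b0 z : 0 <= b z by exact: mulr_ge0.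
have split0 G : measurable_fun setT G -> (forall z, (0 <= G z)%E) ->
    (\int[P]_w (G (X w, Z w) * (q' (X w, Z w))%:E) =
     \int[M]_z (G z * (a z)%:E))%E.
  move=> mG G0; rewrite -(integral_posterior mD mXZ q'0 pq')//.
  rewrite (integral_joint mD df0 indep0 pq)// intM//.
    by apply: emeasurable_funM => //; exact/measurable_EFinP.
  by move=> z; rewrite mule_ge0// lee_fin.
have split1 G : measurable_fun setT G -> (forall z, (0 <= G z)%E) ->
    (\int[P]_w (G (X w, Z w) * (1 - q' (X w, Z w))%:E) =
     \int[M]_z (G z * (b z)%:E))%E.
  move=> mG G0; rewrite -(integral_posterior mDC mXZ q'C0 pq'C)//.
  rewrite (integral_joint mDC df1 indep1 pqC)// intM//.
    by apply: emeasurable_funM => //; exact/measurable_EFinP.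
  by move=> z; rewrite mule_ge0// lee_fin.
have mixture G : measurable_fun setT G -> (forall z, (0 <= G z)%E) ->
    (\int[P]_w G (X w, Z w) = \int[M]_z (G z * (a z + b z)%:E))%E.
  move=> mG G0; have mGXZ := measurableT_comp mG mXZ.
  transitivity (\int[P]_w (G (X w, Z w) * (q' (X w, Z w))%:E) +
                \int[P]_w (G (X w, Z w) * (1 - q' (X w, Z w))%:E))%E.
    rewrite -ge0_integralD//.
    - apply: eq_integral => w _; rewrite -ge0_muleDr ?lee_fin//.
      by rewrite -EFinD subrKC mule1.
    - by move=> w _; rewrite mule_ge0// lee_fin.
    - apply: emeasurable_funM => //; apply/measurable_EFinP.
      exact: (measurableT_comp mq' mXZ).
    - by move=> w _; rewrite mule_ge0// lee_fin.
    - apply: emeasurable_funM => //; apply/measurable_EFinP.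
      exact: (measurableT_comp mq'C mXZ).
  rewrite split0// split1// -ge0_integralD//.
  - by apply: eq_integral => z _; rewrite EFinD ge0_muleDr ?lee_fin.
  - by move=> z _; rewrite mule_ge0// lee_fin.
  - by apply: emeasurable_funM => //; exact/measurable_EFinP.
  - by move=> z _; rewrite mule_ge0// lee_fin.
  - by apply: emeasurable_funM => //; exact/measurable_EFinP.
have bayes_rule (r c : T * E -> R) : measurable_fun setT r ->
    (forall z, 0 <= r z <= 1) -> measurable_fun setT c ->
    (forall z, 0 <= c z) ->
    (forall G, measurable_fun setT G -> (forall z, (0 <= G z)%E) ->
      (\int[P]_w (G (X w, Z w) * (r (X w, Z w))%:E) =
       \int[M]_z (G z * (c z)%:E))%E) ->
    ae_eq M setT (fun z => (c z)%:E) (fun z => (r z * (a z + b z))%:E).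
  move=> mr r01 mc c0 rc.
  have r0 z : 0 <= r z by case/andP: (r01 z).
  apply: integral_ae_eq => //.
  - apply/integrableP; split; first exact/measurable_EFinP.
    have -> : (\int[M]_z `|(c z)%:E| = \int[M]_z (cst 1%E z * (c z)%:E))%E.
      by apply: eq_integral => z _; rewrite mul1e gee0_abs// lee_fin.
    rewrite -rc//; apply: (@le_lt_trans _ _ (\int[P]_w (cst 1%E w))%E).
      apply: ge0_le_integral => //.
      - by move=> w _; rewrite mul1e lee_fin.
      - apply: emeasurable_funM => //; apply/measurable_EFinP.
        exact: (measurableT_comp mr mXZ).
      - by move=> w _; rewrite mul1e lee_fin; case/andP: (r01 (X w, Z w)).
    by rewrite integral_cst//= mul1e [X in (X < _)%E]probability_setT ltry.
  - by apply/measurable_EFinP; apply: measurable_funM => //;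
      exact: measurable_funD.
  - move=> B _ mB.
    have mI : measurable_fun setT (fun z => (\1_B z)%:E : \bar R).
      exact/measurable_EFinP/measurable_indic.
    have I0 z : (0 <= (\1_B z)%:E :> \bar R)%E by rewrite lee_fin.
    transitivity (\int[M]_z ((\1_B z)%:E * (c z)%:E))%E.
      rewrite integral_mkcond; apply: eq_integral => z _.
      by rewrite patchE indicE; case: (z \in B); rewrite ?mul1e ?mul0e.
    rewrite -rc// (mixture (fun z => (\1_B z)%:E * (r z)%:E)%E).
    + rewrite [RHS]integral_mkcond; apply: eq_integral => z _.
      by rewrite patchE indicE; case: (z \in B); rewrite ?mul1e ?mul0e ?EFinM.
    + by apply: emeasurable_funM => //; exact/measurable_EFinP.
    + by move=> z; rewrite mule_ge0// lee_fin.
have bayes0 := bayes_rule q' a mq' q'01 ma a0 split0.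
have q'C01 z : 0 <= 1 - q' z <= 1 by rewrite q'C0 lerBlDr lerDl q'0.
have bayes1 := bayes_rule _ b mq'C q'C01 mb b0 split1.
have mV (u v : T * E -> R) : measurable_fun setT u -> measurable_fun setT v ->
    measurable_fun setT (fun z => (V (u z) (v z))%:E).
  move=> mu_ mv_; apply/measurable_EFinP.
  apply: (measurableT_comp (gauge_measurable gV) (g := fun z => (u z, v z))).
  exact: measurable_fun_pair.
pose SE (z : T * E) := (\1_S z.1)%:E : \bar R.
have mSE : measurable_fun setT SE.
  have m1S : measurable_fun setT (\1_S : T -> R) by exact: measurable_indic.
  by apply/measurable_EFinP; exact: (measurableT_comp m1S).
have SE0 z : (0 <= SE z)%E by rewrite lee_fin.
have V0 u v : (0 <= (V u v)%:E)%E by rewrite lee_fin gauge_ge0.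
have restrictE (g : Omega -> R) :
    (\int[P]_(w in X @^-1` S) (g w)%:E =
     \int[P]_w ((\1_S (X w))%:E * (g w)%:E))%E.
  rewrite integral_mkcond; apply: eq_integral => w _.
  have -> : \1_S (X w) = \1_(X @^-1` S) w :> R by rewrite !indicE.
  by rewrite patchE indicE; case: (w \in _); rewrite ?mul1e ?mul0e.
rewrite !restrictE.
rewrite (mixture (fun z => SE z * (V (q' z) (1 - q' z))%:E)%E); last 2 first.
- by apply: emeasurable_funM => //; exact: mV.
- by move=> z; exact: mule_ge0.
transitivity (\int[M]_z (SE z * (V (a z) (b z))%:E))%E.
  apply: ge0_ae_eq_integral => //.
  - apply: emeasurable_funM; first by apply: emeasurable_funM => //; exact: mV.
    by apply/measurable_EFinP; exact: measurable_funD.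
  - by apply: emeasurable_funM => //; exact: mV.
  - by move=> z _; apply: mule_ge0; [exact: mule_ge0|rewrite lee_fin addr_ge0].
  - by move=> z _; exact: mule_ge0.
  - apply: filterS2 bayes0 bayes1 => z /= ez0 ez1 _.
    have {ez0} [ez0] := ez0 Logic.I; have {ez1} [ez1] := ez1 Logic.I.
    rewrite -muleA; congr (_ * _)%E; rewrite -EFinM; congr (_%:E).
    have -> : V (a z) (b z) =
        V ((a z + b z) * q' z) ((a z + b z) * (1 - q' z)).
      by rewrite ![(a z + b z) * _]mulrC -ez0 -ez1.
    rewrite (gauge_homogeneous gV (addr_ge0 (a0 z) (b0 z)) (q'0 z) (q'C0 z)).
    by rewrite mulrC.
rewrite intM//; last 2 first.
- by apply: emeasurable_funM => //; exact: mV.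
- by move=> z; exact: mule_ge0.
rewrite fubini_tonelli1; last 2 first.
- have mG : measurable_fun setT (fun z => SE z * (V (a z) (b z))%:E)%E.
    by apply: emeasurable_funM => //; exact: mV.
  exact: (measurableT_comp mG mXid).
- by move=> z; exact: mule_ge0.
apply: eq_integral => w _; rewrite /fubini_F/= /SE/= ge0_integralZl//.
- by rewrite -averageE.
- apply/measurable_EFinP.
  exact: (measurable_gauge_density df0 df1 gV (q (X w)) (1 - q (X w))).
Qed.

End bayes.

(** * Random variables with finitely many values, tuples of observations *)

Section finitely_valued.
Local Open Scope ereal_scope.
Context {R : realType} d (Omega : measurableType d) (F : finType).
Variables (P : probability Omega R) (a : Omega -> F) (phi : F -> R).
Hypothesis ma : forall u, measurable (a @^-1` [set u]).
Hypothesis phi0 : forall u, (0 <= phi u)%R.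

Let finite_sumE w : phi (a w) =
  (\sum_(u : F) phi u * \1_(a @^-1` [set u]) w)%R.
Proof.
rewrite (bigD1 (a w))//= indicE mem_set//= mulr1 big1 ?addr0// => u ua.
by rewrite indicE memNset ?mulr0//= => /eqP; rewrite eq_sym (negbTE ua).
Qed.

Let measurable_term u :
  measurable_fun setT (fun w => phi u * \1_(a @^-1` [set u]) w)%R.
Proof. by apply: measurable_funM => //; exact: measurable_indic. Qed.

Lemma measurable_finitely_valued : measurable_fun setT (fun w => phi (a w)).
Proof. by under eq_fun do rewrite finite_sumE; exact: measurable_sum. Qed.

Lemma integral_finitely_valued D : measurable D ->
  \int[P]_(w in D) (phi (a w))%:E =
  \sum_(u : F) (phi u)%:E * P (D `&` a @^-1` [set u]).
Proof.
move=> mD; under eq_integral do rewrite finite_sumE -sumEFin.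
rewrite ge0_integral_sum//.
- apply: eq_bigr => u _; under eq_integral do rewrite EFinM.
  rewrite ge0_integralZl//.
  + by rewrite integral_indic// setIC.
  + exact/measurable_EFinP/measurable_indic.
  + by rewrite lee_fin.
- by move=> u; apply: measurable_funTS; exact/measurable_EFinP.
- by move=> u w _; rewrite lee_fin mulr_ge0.
Qed.

End finitely_valued.

Section observation_tuples.
Context d (E : measurableType d).

Lemma tnth_obs t (y : nat -> E) (i : 'I_t) : tnth (obs t y) i = y i.+1.
Proof. by rewrite tnth_mktuple. Qed.

Lemma measurable_obs dO (Omega : measurableType dO) (Y : nat -> Omega -> E) t :
  (forall s, (0 < s)%N -> measurable_fun setT (Y s)) ->
  measurable_fun setT (fun w => obs t (Y ^~ w)).
Proof.
move=> mY; apply/measurable_fun_tnthP => i.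
have -> : (fun z : t.-tuple E => tnth z i) \o (fun w => obs t (Y ^~ w)) =
    Y i.+1 by apply/funext => w; rewrite /= tnth_obs.
exact: mY.
Qed.

Definition truncate t n (tn : (t <= n)%N) (z : n.-tuple E) : t.-tuple E :=
  [tuple tnth z (widen_ord tn i) | i < t].

Lemma truncate_obs t n (tn : (t <= n)%N) (y : nat -> E) :
  truncate tn (obs n y) = obs t y.
Proof. by apply: eq_from_tnth => i; rewrite tnth_mktuple !tnth_obs. Qed.

Lemma measurable_truncate t n (tn : (t <= n)%N) :
  measurable_fun setT (@truncate t n tn).
Proof.
apply/measurable_fun_tnthP => i.
have -> : (fun z : t.-tuple E => tnth z i) \o truncate tn =
    fun z => tnth z (widen_ord tn i).
  by apply/funext => z; rewrite /= tnth_mktuple.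
exact: measurable_tnth.
Qed.

End observation_tuples.

Section boxes.
Local Open Scope ereal_scope.
Context {R : realType} d dE (Omega : measurableType d) (E : measurableType dE).

(** Reduces independence statements to boxes; with the factors c and c' they
    need not be normalized by the probabilities of D and D'. *)
Lemma measure_proportional (P : probability Omega R) n
    (X : Omega -> n.-tuple E) (D D' : set Omega) (c c' : R) :
  measurable_fun setT X -> measurable D -> measurable D' ->
  (0 <= c)%R -> (0 <= c')%R ->
  (forall A : nat -> set E, (forall i, measurable (A i)) ->
    c%:E * P (D `&` [set w | forall i : 'I_n, A i (tnth (X w) i)]) =
    c'%:E * P (D' `&` [set w | forall i : 'I_n, A i (tnth (X w) i)])) ->
  forall B, measurable B ->
    c%:E * P (D `&` X @^-1` B) = c'%:E * P (D' `&` X @^-1` B).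
Proof.
move=> mX mD mD' c0 c'0 cc' B mB.
have mw (k : R) (C : set Omega) : measurable C ->
    measurable_fun setT (fun w => k * \1_C w)%R.
  by move=> mC; apply: measurable_funM => //; exact: measurable_indic.
have w0 (k : R) (C : set Omega) : (0 <= k)%R ->
    forall w, (0 <= k * \1_C w)%R.
  by move=> k0 w; rewrite mulr_ge0.
have imageE (k : R) (C : set Omega) (mC : measurable C) (k0 : (0 <= k)%R) A :
    measurable A ->
    weighted_image P mX (mw k C mC) (w0 k C k0) A = k%:E * P (C `&` X @^-1` A).
  move=> mA; rewrite /weighted_image; under eq_integral do rewrite EFinM.
  have mXA : measurable (X @^-1` A) by exact: preimage_measurable.
  rewrite ge0_integralZl//; first by rewrite integral_indic.
  by apply/measurable_EFinP; apply: measurable_indic.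
rewrite -(imageE _ _ mD c0)// -(imageE _ _ mD' c'0)//.
apply: (@eq_measure_tuple _ _ _ _ (weighted_image P mX (mw c D mD) (w0 c D c0))
  (weighted_image P mX (mw c' D' mD') (w0 c' D' c'0))) => //=.
  rewrite imageE// lte_mul_pinfty ?lee_fin//.
  by rewrite (le_lt_trans (probability_le1 _ _))// ?ltry//;
    exact/measurableI/preimage_measurable.
by move=> A mA; rewrite !imageE//; [exact: cc'|exact: measurable_box..].
Qed.

End boxes.

(** * Conditional independence of the observations *)

Section observations.
Context {R : realType} {d d1 d2 : measure_display}.
Context {Omega : measurableType d} {E1 : measurableType d1}
  {E2 : measurableType d2}.
Variables (P : probability Omega R) (H : Omega -> bool)
  (Y1 : nat -> Omega -> E1) (Y2 : nat -> Omega -> E2)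
  (mu1 : nat -> {sigma_finite_measure set E1 -> \bar R})
  (mu2 : nat -> {sigma_finite_measure set E2 -> \bar R})
  (f1 : nat -> bool -> E1 -> R) (f2 : nat -> bool -> E2 -> R).
Hypothesis model : observation_model P H Y1 Y2 mu1 mu2 f1 f2.

Let X1 t w := obs t (Y1 ^~ w).
Let X2 t w := obs t (Y2 ^~ w).

Lemma measurable_hypothesis h : measurable [set w | H w = h].
Proof.
have [mH _ _ _] := model.
by rewrite -[X in measurable X]setTI; exact: (mH measurableT [set h]).
Qed.

Lemma setC_hypothesis h : ~` [set w | H w = h] = [set w | H w = ~~ h].
Proof. by apply/seteqP; split => w /=; case: (H w); case: h. Qed.

Lemma measurable_X1 t : measurable_fun setT (X1 t).
Proof.
by have [_ mY _ _] := model; apply: measurable_obs => s /mY[].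
Qed.

Lemma measurable_X2 t : measurable_fun setT (X2 t).
Proof.
by have [_ mY _ _] := model; apply: measurable_obs => s /mY[].
Qed.

Let Q1 h t (A : set E1) := (\int[mu1 t]_(y in A) (f1 t h y)%:E)%E.
Let Q2 h t (B : set E2) := (\int[mu2 t]_(y in B) (f2 t h y)%:E)%E.

Let integral_density_fin dE (E : measurableType dE)
    (mu : {sigma_finite_measure set E -> \bar R}) (f : E -> R) A :
  is_density mu f -> measurable A ->
  (0 <= \int[mu]_(y in A) (f y)%:E <= 1)%E.
Proof.
move=> [mf f0 If] mA; rewrite integral_ge0/=; last first.
  by move=> y _; rewrite lee_fin.
rewrite -If; apply: ge0_subset_integral => //; first exact/measurable_EFinP.
by move=> y _; rewrite lee_fin.
Qed.

Let Q1_fin h t A : (0 < t)%N -> measurable A ->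
  exists2 r : R, 0 <= r & Q1 h t A = r%:E.
Proof.
move=> t0 mA; have [_ _ /(_ t h t0)[df _] _] := model.
have /andP[Q0 Qle1] := integral_density_fin df mA.
exists (fine (Q1 h t A)); first exact: fine_ge0.
by rewrite fineK// ge0_fin_numE// (le_lt_trans Qle1)// ltry.
Qed.

Let P_fin A : measurable A -> P A = (fine (P A))%:E.
Proof. by move=> mA; rewrite fineK// fin_num_measure. Qed.

Let prod_fin (Q : nat -> \bar R) n :
  (forall t, (0 < t)%N -> exists2 r : R, 0 <= r & Q t = r%:E) ->
  exists2 r : R, 0 <= r & (\prod_(1 <= t < n.+1) Q t = r%:E)%E.
Proof.
move=> Qfin; elim: n => [|n [r r0 IH]]; first by exists 1; rewrite ?big_nil.
have [s s0 Qs] := Qfin n.+1 isT; exists (r * s); first exact: mulr_ge0.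
by rewrite big_nat_recr//= IH Qs EFinM.
Qed.

Let prod_setT n h :
  (\prod_(1 <= t < n.+1) Q1 h t setT = 1 /\
   \prod_(1 <= t < n.+1) Q2 h t setT = 1)%E.
Proof.
have [_ _ dens _] := model.
by split; rewrite big_nat_cond big1// => t /andP[/andP[t0 _] _];
  have [[_ _ ?] [_ _ ?]] := dens t h t0.
Qed.

Lemma next_observation_model t h :
  next_observation P (mu1 t.+1) (X1 t) (Y1 t.+1) [set w | H w = h] (f1 t.+1 h).
Proof.
move=> A C mA mC; have [_ mY dens PE] := model.
have mh := measurable_hypothesis h.
have mYC : measurable (Y1 t.+1 @^-1` C).
  by apply: preimage_measurable => //; have [] := mY t.+1 isT.
have [q q0 qE] := Q1_fin h (isT : (0 < t.+1)%N) mC.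
rewrite -/(Q1 _ _ _) qE muleC setIAC -[LHS]mul1e.
apply: (@measure_proportional R _ _ _ _ P t (X1 t)) => //.
- exact: measurable_X1.
- exact: measurableI.
move=> {mA}A mA; rewrite mul1e.
pose A' s := if (s <= t)%N then A s.-1 else C.
have mA' s : measurable (A' s) by rewrite /A'; case: ifP.
pose A0 s := if (s <= t)%N then A s.-1 else setT.
have mA0 s : measurable (A0 s) by rewrite /A0; case: ifP.
have boxE w : (forall i : 'I_t, A i (tnth (X1 t w) i)) <->
    (forall s, (0 < s <= t)%N -> A s.-1 (Y1 s w)).
  split=> [Aw [//|s] /= st|Aw i]; last by
    rewrite tnth_obs; exact: (Aw i.+1 (ltn_ord i)).
  by have := Aw (Ordinal st); rewrite tnth_obs.
have -> : [set w | H w = h] `&` Y1 t.+1 @^-1` C `&`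
      [set w | forall i : 'I_t, A i (tnth (X1 t w) i)] =
    [set w | H w = h /\ forall s, (0 < s <= t.+1)%N ->
      A' s (Y1 s w) /\ setT (Y2 s w)].
  apply/seteqP; split => w /=.
    move=> [[hw Cw] /boxE Aw]; split=> // s /andP[s0 st1]; split => //; rewrite /A'.
    case: leqP => [st|ts]; first by apply: Aw; rewrite s0.
    by have -> : s = t.+1 by apply/eqP; rewrite eqn_leq st1 ts.
  move=> [hw Aw]; split; [split => //|apply/boxE => s /andP[s0 st]].
    by have [] := Aw t.+1; rewrite ?leqnn// /A' ltnn.
  by have [] := Aw s; rewrite ?s0 ?(leqW st)// /A' st.
rewrite (PE h t.+1 A' (fun=> setT))//.
have -> : [set w | H w = h] `&`
      [set w | forall i : 'I_t, A i (tnth (X1 t w) i)] =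
    [set w | H w = h /\ forall s, (0 < s <= t)%N ->
      A0 s (Y1 s w) /\ setT (Y2 s w)].
  apply/seteqP; split => w /=.
    move=> [hw /boxE Aw]; split=> // s /andP[s0 st]; split => //; rewrite /A0 st.
    by apply: Aw; rewrite s0.
  move=> [hw Aw]; split => //; apply/boxE => s /andP[s0 st].
  by have [] := Aw s; rewrite ?s0 ?st// /A0 st.
rewrite (PE h t A0 (fun=> setT))//.
have [_ p1] := prod_setT t.+1 h; have [_ p2] := prod_setT t h.
rewrite [X in (_ * _ * X)%E = _]p1 [X in _ = (_ * (_ * _ * X))%E]p2.
rewrite !mule1 big_nat_recr//= /A' ltnn -/(Q1 _ _ _) qE muleA muleC.
congr (_ * (_ * _))%E.
rewrite !big_nat; apply: eq_bigr => s /andP[_].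
by rewrite ltnS /A0 => ->.
Qed.

(** Two extensions from boxes to measurable sets: first in the observations of
    O2 for a fixed box of observations of O1, then in those of O1. *)
Lemma conditional_independence n h (A : set (n.-tuple E1))
    (B : set (n.-tuple E2)) : measurable A -> measurable B ->
  (P [set w | H w = h] *
     P ([set w | H w = h] `&` X2 n @^-1` B `&` X1 n @^-1` A) =
   P ([set w | H w = h] `&` X2 n @^-1` B) *
     P ([set w | H w = h] `&` X1 n @^-1` A))%E.
Proof.
move=> mA mB; have [_ mY dens PE] := model.
have mh := measurable_hypothesis h.
have mX2B : measurable (X2 n @^-1` B).
  by apply: preimage_measurable => //; exact: measurable_X2.
rewrite (P_fin mh) (P_fin (measurableI _ _ mh mX2B)).
apply: (measure_proportional (X := X1 n)) => //.
- exact: measurable_X1.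
- exact: measurableI.
- exact/fine_ge0.
- exact/fine_ge0.
move=> {mA}A mA.
rewrite -(P_fin mh) -(P_fin (measurableI _ _ mh mX2B)).
have [a a0 aE] : exists2 r : R, 0 <= r &
    (\prod_(1 <= t < n.+1) Q1 h t (A t.-1) = r%:E)%E.
  by apply: prod_fin => t t0; exact: Q1_fin.
have box1E w : (forall i : 'I_n, A i (tnth (X1 n w) i)) <->
    (forall s, (0 < s <= n)%N -> A s.-1 (Y1 s w)).
  split=> [Aw [//|s] /= st|Aw i]; last by
    rewrite tnth_obs; exact: (Aw i.+1 (ltn_ord i)).
  by have := Aw (Ordinal st); rewrite tnth_obs.
pose SA := [set w | forall i : 'I_n, A i (tnth (X1 n w) i)].
have mSA : measurable SA.
  exact: (preimage_measurable (@measurable_X1 n) (measurable_box mA)).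
have PA : (P ([set w | H w = h] `&` SA) = P [set w | H w = h] * a%:E)%E.
  rewrite -aE (_ : _ `&` _ = [set w | H w = h /\ forall s, (0 < s <= n)%N ->
    A s.-1 (Y1 s w) /\ setT (Y2 s w)]).
    rewrite (PE h n (fun s => A s.-1) (fun=> setT))//.
    by have [_ p1] := prod_setT n h; rewrite [X in (_ * _ * X)%E]p1 mule1.
  apply/seteqP; split => w /=.
    by move=> [hw /box1E Aw]; split=> // s /Aw.
  by move=> [hw Aw]; split => //; apply/box1E => s /Aw[].
(* the same identity for the sets of observations of O2 that are not boxes *)
have PAB : (1%:E * P ([set w | H w = h] `&` SA `&` X2 n @^-1` B) =
    a%:E * P ([set w | H w = h] `&` X2 n @^-1` B))%E.
  apply: (measure_proportional (X := X2 n)) => //.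
  - exact: measurable_X2.
  - exact: measurableI.
  move=> {mB mX2B}B mB; rewrite mul1e.
  have box2E w : (forall i : 'I_n, B i (tnth (X2 n w) i)) <->
      (forall s, (0 < s <= n)%N -> B s.-1 (Y2 s w)).
    split=> [Aw [//|s] /= st|Aw i]; last by
    rewrite tnth_obs; exact: (Aw i.+1 (ltn_ord i)).
    by have := Aw (Ordinal st); rewrite tnth_obs.
  rewrite (_ : _ `&` _ = [set w | H w = h /\ forall s, (0 < s <= n)%N ->
      A s.-1 (Y1 s w) /\ B s.-1 (Y2 s w)]); last first.
    apply/seteqP; split => w /=.
      by move=> [[hw /box1E Aw] /box2E Bw]; split=> // s sn; split;
        [exact: Aw|exact: Bw].
    move=> [hw Aw]; split; first split => //.
      by apply/box1E => s /Aw[].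
    by apply/box2E => s /Aw[].
  rewrite [in RHS](_ : _ `&` _ = [set w | H w = h /\ forall s, (0 < s <= n)%N ->
      setT (Y1 s w) /\ B s.-1 (Y2 s w)]); last first.
    apply/seteqP; split => w /=.
      by move=> [hw /box2E Bw]; split=> // s sn; split => //; exact: Bw.
    by move=> [hw Aw]; split => //; apply/box2E => s /Aw[].
  rewrite (PE h n (fun s => A s.-1) (fun s => B s.-1))//.
  rewrite (PE h n (fun=> setT) (fun s => B s.-1))//.
  have [p1 _] := prod_setT n h; rewrite [X in (_ * X * _)%E = _]aE.
  by rewrite [X in _ = (_ * (_ * X * _))%E]p1 mule1 muleA (muleC a%:E).
by rewrite setIAC -[X in (_ * X)%E]mul1e PAB PA muleCA [RHS]muleCA muleC
  -muleA muleC.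
Qed.

End observations.

(** * The cost of a final message of O1 *)

Section first_times.

Lemma first_time_eq (p : pred nat) a n t : (a <= t <= n)%N -> p t ->
  (forall s, (a <= s < t)%N -> ~~ p s) -> first_time p a n = t.
Proof.
move=> /andP[at_ tn] pt pNs; rewrite /first_time.
have -> : (n.+1 - a = (t - a) + (n - t).+1)%N.
  by rewrite addnS addnBAC// subnKC// subSn// (leq_trans at_).
rewrite iotaD find_cat ifF; last first.
  apply/hasPn => s; rewrite mem_iota subnKC// => /pNs ->; rewrite //.
rewrite size_iota subnKC//= pt addn0 subnKC//.
Qed.

Lemma eq_in_first_time (p q : pred nat) a n :
  (forall s, (a <= s <= n)%N -> p s = q s) ->
  first_time p a n = first_time q a n.
Proof.
move=> pq; rewrite /first_time; congr (_ + _)%N; apply: eq_in_find => s.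
rewrite mem_iota => /andP[as_]; have [an|na] := leqP a n.+1.
  by rewrite subnKC// ltnS => sn; apply: pq; rewrite as_.
by rewrite (eqP (ltnW na)) addn0 ltnNge as_.
Qed.

Lemma first_time_bounds (p : pred nat) a n :
  (exists2 t, (a <= t <= n)%N & p t) -> (a <= first_time p a n <= n)%N.
Proof.
move=> [t /andP[at_ tn] pt]; rewrite /first_time leq_addr/=.
have : has p (iota a (n.+1 - a)).
  by apply/hasP; exists t => //; rewrite mem_iota at_ subnKC// leqW//
    (leq_trans at_).
by rewrite has_find size_iota ltn_subRL ltnS.
Qed.

End first_times.

Section stopping.
Context {R : realType} {d1} {E1 : measurableType d1} {E2 : Type}.
Variables (pb : problem) (T1 T2 : nat) (c1 c2 : R) (J : bool -> bool -> R).

Definition final_messages (t : nat) (m : bool) : seq (option bool) :=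
  rcons (nseq t.-1 None) (Some m).

Lemma messages_stopped (g : policy1 E1) (y : nat -> E1) t m :
  (0 < t <= T1)%N -> (forall s, (0 < s < t)%N -> g s (obs s y) = None) ->
  g t (obs t y) = Some m ->
  tau1 T1 g y = t /\ messages T1 g y = final_messages t m.
Proof.
move=> tT gN gt; have tau : tau1 T1 g y = t.
  by apply: first_time_eq => //; [rewrite gt|move=> s /gN ->].
split=> //; rewrite /messages tau /final_messages.
case: t tT gN gt {tau} => // t _ gN gt.
have -> : iota 1 t.+1 = rcons (iota 1 t) t.+1.
  by rewrite -(addn1 t) iotaD/= add1n addn1 cats1.
rewrite map_rcons gt; congr rcons.
apply: (@eq_from_nth _ None); rewrite ?size_map ?size_iota ?size_nseq// => i it.
rewrite (nth_map 0%N) ?size_iota// nth_iota// nth_nseq it gN//.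
Qed.

(** O2 sees O1 only through its messages, and these are determined by the time
    and the value of the final one. *)
Lemma run_cost_stopped (g : policy1 E1) (g2 : policy2 E2) (y : nat -> E1)
    (y' : nat -> E2) t m h :
  (0 < t <= T1)%N -> (forall s, (0 < s < t)%N -> g s (obs s y) = None) ->
  g t (obs t y) = Some m ->
  run_cost pb T1 T2 c1 c2 J g g2 y y' h =
  run_cost pb T1 T2 c1 c2 J (send_at t m) g2 y y' h.
Proof.
move=> tT gN gt; have [tau mess] := messages_stopped tT gN gt.
have [tau' mess'] : tau1 T1 (@send_at _ E1 t m) y = t /\
    messages T1 (@send_at _ E1 t m) y = final_messages t m.
  apply: messages_stopped => //; last by rewrite /send_at ltnn.
  by move=> s /andP[_ st]; rewrite /send_at st.
by rewrite /run_cost /decision /tau2 /action2 tau tau' mess mess'.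
Qed.

End stopping.

Section stopping_cost.
Context {R : realType} {d d1 d2 : measure_display}.
Context {Omega : measurableType d} {E1 : measurableType d1}
  {E2 : measurableType d2}.
Variables (P : probability Omega R) (H : Omega -> bool)
  (Y1 : nat -> Omega -> E1) (Y2 : nat -> Omega -> E2)
  (mu1 : nat -> {sigma_finite_measure set E1 -> \bar R})
  (mu2 : nat -> {sigma_finite_measure set E2 -> \bar R})
  (f1 : nat -> bool -> E1 -> R) (f2 : nat -> bool -> E2 -> R).
Hypothesis model : observation_model P H Y1 Y2 mu1 mu2 f1 f2.
Variables (pb : problem) (T1 T2 : nat) (c1 c2 : R) (J : bool -> bool -> R)
  (g2 : policy2 E2).
Hypotheses (T1_gt0 : (0 < T1)%N) (T12 : pb = P2 -> (T1 <= T2)%N)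
  (c1_ge0 : 0 <= c1) (c2_ge0 : 0 <= c2) (J_ge0 : forall u h, 0 <= J u h)
  (adm2 : admissible2 pb T1 T2 g2).

Let X1 t w := obs t (Y1 ^~ w).
Let X2 t w := obs t (Y2 ^~ w).
Let cost t m w := random_cost pb T1 T2 c1 c2 J H Y1 Y2 (@send_at _ E1 t m) g2 w.

(** The cost of the message m at time t is a function of the hypothesis and of
    the finitely many actions that O2 would take at its stages; the stage 0,
    which does not exist in P2, is given a dummy action. *)
Let actions t m w : {ffun 'I_T2.+1 -> option bool} :=
  [ffun i : 'I_T2.+1 => if (first_stage pb <= i)%N then
     g2 (X2 i w) (received pb i (final_messages t m)) else None].

Let stage_cost t (u : bool * {ffun 'I_T2.+1 -> option bool}) : R :=
  let tau := first_time (fun s => u.2 (inord s) != None) (first_stage pb) T2 in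
  c1 * t%:R + c2 * tau%:R + J (odflt false (u.2 (inord tau))) u.1.

Let stage_cost_ge0 t u : 0 <= stage_cost t u.
Proof. by rewrite /stage_cost !addr_ge0// mulr_ge0. Qed.

Let costE t m w : (0 < t <= T1)%N ->
  cost t m w = stage_cost t (H w, actions t m w).
Proof.
move=> tT.
have [tau mess] : tau1 T1 (@send_at _ E1 t m) (Y1 ^~ w) = t /\
    messages T1 (@send_at _ E1 t m) (Y1 ^~ w) = final_messages t m.
  apply: messages_stopped => //; last by rewrite /send_at ltnn.
  by move=> s /andP[_ st]; rewrite /send_at st.
have actE s : (first_stage pb <= s <= T2)%N -> actions t m w (inord s) =
    action2 pb T1 (@send_at _ E1 t m) g2 (Y1 ^~ w) (Y2 ^~ w) s.
  move=> /andP[fs sT]; rewrite ffunE /action2 mess.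
  by rewrite !inordK ?ltnS// fs.
have tau2E : first_time (fun s => actions t m w (inord s) != None)
    (first_stage pb) T2 =
    tau2 pb T1 T2 (@send_at _ E1 t m) g2 (Y1 ^~ w) (Y2 ^~ w).
  by apply: eq_in_first_time => s /actE ->.
rewrite /cost /random_cost /run_cost /stage_cost /= tau2E tau.
rewrite /decision actE//; apply: first_time_bounds; apply: contrapT => never.
have fT : (first_stage pb <= T2)%N.
  by case pbE : pb => //=; exact: leq_trans T1_gt0 (T12 pbE).
have none s : (first_stage pb <= s <= T2)%N ->
    action2 pb T1 (@send_at _ E1 t m) g2 (Y1 ^~ w) (Y2 ^~ w) s = None.
  by move=> sT; apply: contrapT => /eqP sN; apply: never; exists s.
have [_ /(_ (Y2 ^~ w) (final_messages t m))] := adm2; apply.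
- by exists t, m.
- move=> s /andP[fs sT]; have := none s; rewrite /action2 mess; apply.
  by rewrite fs ltnW.
- by have := none T2; rewrite /action2 mess; apply; rewrite fT leqnn.
Qed.

Let n := maxn T1 T2.

Let actions_observed t m v : exists2 B : set (n.-tuple E2), measurable B &
  actions t m @^-1` [set v] = X2 n @^-1` B.
Proof.
have iT (i : 'I_T2.+1) : (i <= n)%N.
  by rewrite (leq_trans _ (leq_maxr _ _))// -ltnS.
pose Bi (i : 'I_T2.+1) := [set z : n.-tuple E2 |
  (if (first_stage pb <= i)%N then g2 (truncate (iT i) z)
     (received pb i (final_messages t m)) else None) = v i].
exists (\bigcap_(i in [set: 'I_T2.+1]) Bi i).
  apply: fin_bigcap_measurable => // i _; rewrite /Bi.
  case: (boolP (first_stage pb <= i)%N) => fi; last first.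
    have [<-|vN] := pselect (None = v i).
      by rewrite (_ : [set _ | _] = setT)//; apply/seteqP; split.
    by rewrite (_ : [set _ | _] = set0)//; apply/seteqP; split.
  have [mg2 _] := adm2.
  have := mg2 i (received pb i (final_messages t m)) (v i).
  rewrite fi -[(i <= T2)%N]ltnS ltn_ord => /(_ isT) mB.
  exact: (preimage_measurable (measurable_truncate (iT i)) mB).
apply/seteqP; split => w /=.
  by move=> av i _; rewrite /Bi/= truncate_obs -av ffunE.
by move=> wB; apply/ffunP => i; have := wB i Logic.I;
  rewrite /Bi/= truncate_obs ffunE.
Qed.

Let outcome t m w := (H w, actions t m w).

Let outcome_preimage t m h v :
  outcome t m @^-1` [set (h, v)] =
  [set w | H w = h] `&` actions t m @^-1` [set v].
Proof. by apply/seteqP; split => w /=; [case=> -> ->|case=> <- <-]. Qed.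

Let measurable_outcome t m u : measurable (outcome t m @^-1` [set u]).
Proof.
case: u => h v; rewrite outcome_preimage.
apply: measurableI; first exact: (measurable_hypothesis model).
have [B mB ->] := actions_observed t m v.
have mX2 := measurable_X2 model (t := n).
exact: (preimage_measurable mX2 mB).
Qed.

Lemma measurable_stopping_cost t m : (0 < t <= T1)%N ->
  measurable_fun setT (cost t m).
Proof.
move=> tT; have := measurable_finitely_valued (stage_cost t)
  (measurable_outcome t m).
by congr (measurable_fun _ _); apply/funext => w; rewrite costE.
Qed.

(** The conditional expectation of the cost of the message m at time t given
    H = h (the quotient is 0 if H = h has probability 0). *)
Definition mean_cost t m h : R :=
  fine (\int[P]_(w in [set w | H w = h]) (cost t m w)%:E)%E /
  fine (P [set w | H w = h]).

Lemma integral_cost_fin t m h : (0 < t <= T1)%N ->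
  (\int[P]_(w in [set w | H w = h]) (cost t m w)%:E \is a fin_num)%E.
Proof.
move=> tT; have mh := measurable_hypothesis model h.
under eq_integral do rewrite costE//.
rewrite (integral_finitely_valued P (measurable_outcome t m)
  (stage_cost_ge0 t))//.
apply/sum_fin_numP => u _ _; rewrite fin_numM// fin_num_measure//.
exact: measurableI.
Qed.

Lemma mean_cost_ge0 t m h : (0 < t <= T1)%N -> 0 <= mean_cost t m h.
Proof.
move=> tT; rewrite /mean_cost divr_ge0// fine_ge0// integral_ge0// => w _.
by rewrite lee_fin costE.
Qed.

Lemma integral_cost_given t m h (B : set (t.-tuple E1)) : (0 < t <= T1)%N ->
  measurable B ->
  (\int[P]_(w in [set w | H w = h] `&` X1 t @^-1` B) (cost t m w)%:E =
   (mean_cost t m h)%:E * P ([set w | H w = h] `&` X1 t @^-1` B))%E.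
Proof.
move=> tT mB; set Dh := [set w | H w = h]; set S := Dh `&` _.
have mDh : measurable Dh := measurable_hypothesis model h.
have tn : (t <= n)%N.
  by case/andP: tT => _ tT; rewrite (leq_trans tT)// leq_maxl.
pose B' := truncate tn @^-1` B.
have mB' : measurable B' := preimage_measurable (measurable_truncate tn) mB.
have SE : S = Dh `&` X1 n @^-1` B'.
  by rewrite /S /B'; congr (_ `&` _); apply/seteqP; split => w /=;
    rewrite truncate_obs.
have mS : measurable S.
  have mX1 := measurable_X1 model (t := t).
  by apply: measurableI => //; exact: (preimage_measurable mX1 mB).
have prop : (P Dh * \int[P]_(w in S) (cost t m w)%:E =
    P S * \int[P]_(w in Dh) (cost t m w)%:E)%E.
  under eq_integral do rewrite costE//.
  under [in RHS]eq_integral do rewrite costE//.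
  rewrite !(integral_finitely_valued P (measurable_outcome t m)
    (stage_cost_ge0 t))//.
  rewrite !ge0_sume_distrr; [|by move=> u _; rewrite mule_ge0 ?lee_fin..].
  apply: eq_bigr => -[h' v] _; rewrite muleCA [RHS]muleCA; congr (_ * _)%E.
  rewrite outcome_preimage.
  have [<-|h'h] := eqVneq h h'; last first.
    have E0 : Dh `&` [set w | H w = h'] = set0.
      by apply/seteqP; split => w // [/= hw]; rewrite hw => /eqP;
        rewrite (negbTE h'h).
    by rewrite SE setIACA [in RHS]setIA E0 !set0I measure0 !mule0.
  have [C mC ->] := actions_observed t m v.
  rewrite SE setIACA setIid (setIC (X1 n @^-1` B')) setIA.
  rewrite [in RHS]setIA setIid [RHS]muleC.
  exact: (conditional_independence model).
have [P0|P0] := eqVneq (fine (P Dh)) 0.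
  have PDh0 : P Dh = 0%E.
    by rewrite -[LHS]fineK ?P0// fin_num_measure.
  have PS0 : P S = 0%E by apply: (subset_measure0 _ _ _ PDh0) => // w [].
  rewrite PS0 mule0; under eq_integral do rewrite costE//.
  rewrite (integral_finitely_valued P (measurable_outcome t m)
    (stage_cost_ge0 t))// big1// => u _.
  suff -> : P (S `&` outcome t m @^-1` [set u]) = 0%E by rewrite mule0.
  by apply: (subset_measure0 _ _ _ PS0) => //; exact: measurableI.
have PDhE : P Dh = (fine (P Dh))%:E by rewrite fineK// fin_num_measure.
have := integral_cost_fin m h tT; rewrite -/Dh => /fineK kE.
move: prop; rewrite PDhE -{1}kE => /(congr1 (fun x => (fine (P Dh))^-1%:E * x)%E).
rewrite muleA -EFinM mulVf// mul1e => ->.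
by rewrite muleCA -EFinM muleC mulrC.
Qed.

(** Given the hypothesis, the cost of a message depends only on the observations
    of O2, hence is independent of those of O1; so, given the latter, its
    expectation is the average of the two mean costs under the belief. *)
Lemma integral_stopping_cost t m (q : t.-tuple E1 -> R) (B : set (t.-tuple E1)) :
  (0 < t <= T1)%N -> measurable B ->
  posterior P [set w | H w = false] (X1 t) q -> (forall z, 0 <= q z <= 1) ->
  (\int[P]_(w in X1 t @^-1` B) (cost t m w)%:E =
   \int[P]_(w in X1 t @^-1` B)
     (mean_cost t m false * `|q (X1 t w)| +
      mean_cost t m true * `|1 - q (X1 t w)|)%:E)%E.
Proof.
move=> tT mB pq q01; have mX := measurable_X1 model (t := t).
have mXB : measurable (X1 t @^-1` B) := preimage_measurable mX mB.
have mh h := measurable_hypothesis model h.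
have mq : measurable_fun setT (q \o X1 t).
  by apply: (measurableT_comp _ mX); have [] := pq.
have q0 z : 0 <= q z by case/andP: (q01 z).
have qC0 z : 0 <= 1 - q z by rewrite subr_ge0; case/andP: (q01 z).
have splitB : X1 t @^-1` B = ([set w | H w = false] `&` X1 t @^-1` B) `|`
    ([set w | H w = true] `&` X1 t @^-1` B).
  by rewrite -setIUl -(setC_hypothesis H true) setUC setUv setTI.
have mqB : measurable_fun (X1 t @^-1` B) (fun w => (q (X1 t w))%:E).
  by apply: measurable_funTS; exact/measurable_EFinP.
have mqCB : measurable_fun (X1 t @^-1` B) (fun w => (1 - q (X1 t w))%:E).
  by apply: measurable_funTS; apply/measurable_EFinP; exact: measurable_funB.
have k0 h : (0 <= (mean_cost t m h)%:E)%E by rewrite lee_fin mean_cost_ge0.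
rewrite {1}splitB ge0_integral_setU//=.
- rewrite !integral_cost_given//.
  have [_ <-//] := pq.
  have := posterior_setC (mh false) mX q01 pq.
  rewrite setC_hypothesis => -[_ <-//].
  rewrite -ge0_integralZl//; last by move=> w _; rewrite lee_fin.
  rewrite -ge0_integralZl//; last by move=> w _; rewrite lee_fin.
  rewrite -ge0_integralD//.
  + by apply: eq_integral => w _; rewrite -!EFinM -EFinD !ger0_norm.
  + by move=> w _; rewrite mule_ge0// lee_fin.
  + exact: emeasurable_funM.
  + by move=> w _; rewrite mule_ge0// lee_fin.
  + exact: emeasurable_funM.
- exact: measurableI.
- exact: measurableI.
- apply: measurable_funTS; apply/measurable_EFinP.
  exact: measurable_stopping_cost.
- by move=> w _; rewrite lee_fin costE.
- by apply/disj_set2P; rewrite setIACA -(setC_hypothesis H true) setICl set0I.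
Qed.

End stopping_cost.

Section appending.
Context d (E : measurableType d).

Definition append t (z : t.-tuple E * E) : t.+1.-tuple E :=
  [tuple of rcons z.1 z.2].

Definition last_split t (z : t.+1.-tuple E) : t.-tuple E * E :=
  (truncate (leqnSn t) z, tnth z ord_max).

Lemma append_obs t (y : nat -> E) : append (obs t y, y t.+1) = obs t.+1 y.
Proof.
apply: eq_from_tnth => i; rewrite tnth_obs (tnth_nth (y 0%N)).
rewrite -[LHS]/(nth (y 0%N) (rcons (obs t y) (y t.+1)) i) nth_rcons.
rewrite (@size_tuple t _ (obs t y)); case: ltnP => [it|ti].
  exact: (nth_mktuple (fun j : 'I_t => y j.+1) (y 0%N) (Ordinal it)).
have -> : i = t :> nat by apply/eqP; rewrite eqn_leq ti -ltnS ltn_ord.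
by rewrite eqxx.
Qed.

Lemma last_split_obs t (y : nat -> E) :
  last_split (obs t.+1 y) = (obs t y, y t.+1).
Proof. by rewrite /last_split truncate_obs tnth_obs. Qed.

Lemma measurable_append t : measurable_fun setT (@append t).
Proof.
apply/measurable_fun_tnthP => i; have [it|ti] := ltnP i t.
- rewrite (_ : _ \o _ = fun z => tnth z.1 (Ordinal it)).
    exact: (measurableT_comp (measurable_tnth (Ordinal it))).
  apply/funext => z /=; rewrite (tnth_nth z.2)/= nth_rcons size_tuple it.
  by rewrite (tnth_nth z.2).
- rewrite (_ : _ \o _ = snd) //; apply/funext => z /=.
  rewrite (tnth_nth z.2)/= nth_rcons size_tuple ltnNge ti/=.
  by rewrite eqn_leq ti -ltnS ltn_ord.
Qed.

Lemma measurable_last_split t : measurable_fun setT (@last_split t).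
Proof.
apply: measurable_fun_pair; first exact: measurable_truncate.
exact: measurable_tnth.
Qed.

End appending.

(** * Dynamic programming for O1 *)

Section dynamic_programming.
Context {R : realType} {d d1 d2 : measure_display}.
Context {Omega : measurableType d} {E1 : measurableType d1}
  {E2 : measurableType d2}.
Variables (P : probability Omega R) (H : Omega -> bool)
  (Y1 : nat -> Omega -> E1) (Y2 : nat -> Omega -> E2)
  (mu1 : nat -> {sigma_finite_measure set E1 -> \bar R})
  (mu2 : nat -> {sigma_finite_measure set E2 -> \bar R})
  (f1 : nat -> bool -> E1 -> R) (f2 : nat -> bool -> E2 -> R).
Hypothesis model : observation_model P H Y1 Y2 mu1 mu2 f1 f2.
Variables (pb : problem) (T1 T2 : nat) (c1 c2 : R) (J : bool -> bool -> R)
  (g2 : policy2 E2).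
Hypotheses (T1_gt0 : (0 < T1)%N) (T12 : pb = P2 -> (T1 <= T2)%N)
  (c1_ge0 : 0 <= c1) (c2_ge0 : 0 <= c2) (J_ge0 : forall u h, 0 <= J u h)
  (adm2 : admissible2 pb T1 T2 g2).
Variable pi : forall t : nat, t.-tuple E1 -> R.
Hypothesis belief : is_belief P H Y1 T1 pi.

Let X1 t w := obs t (Y1 ^~ w).
Let D0 := [set w | H w = false].

Let q t (z : t.-tuple E1) : R := clamp (pi z).

Let q01 t (z : t.-tuple E1) : 0 <= q z <= 1. Proof. exact: clamp01. Qed.

Let mD0 : measurable D0. Proof. exact: (measurable_hypothesis model). Qed.

Let mX1 t : measurable_fun setT (X1 t).
Proof. exact: (measurable_X1 model). Qed.

Let posterior_pi t : (0 < t <= T1)%N -> posterior P D0 (X1 t) (@pi t).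
Proof. by move=> /belief[mpi piE]; split. Qed.

Let posterior_q t : (0 < t <= T1)%N -> posterior P D0 (X1 t) (@q t).
Proof. by move=> tT; exact: (posterior_clamp mD0 (@mX1 t) (posterior_pi tT)). Qed.

Lemma ae_belief01 t : (0 < t <= T1)%N ->
  {ae P, forall w, 0 <= pi (X1 t w) <= 1}.
Proof.
by move=> tT; exact: (posterior_ae01 mD0 (@mX1 t) (posterior_pi tT)).
Qed.

Definition stop_cost t m (u v : R) : R :=
  mean_cost P H Y1 Y2 pb T1 T2 c1 c2 J g2 t m false * `|u| +
  mean_cost P H Y1 Y2 pb T1 T2 c1 c2 J g2 t m true * `|v|.

(** The optimal total cost, seen from time t with k = T1 - t stages left.  At the
    horizon O1 cannot wait; the cost of waiting is then set to that of sending
    0, which does not change the minimum. *)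
Fixpoint value k t (u v : R) : R :=
  Num.min (Num.min (stop_cost t true u v) (stop_cost t false u v))
    (if k is k'.+1 then
       average (mu1 t.+1) (f1 t.+1 false) (f1 t.+1 true) (value k' t.+1) u v
     else stop_cost t false u v).

Definition wait_cost k t (u v : R) : R :=
  if k is k'.+1 then
    average (mu1 t.+1) (f1 t.+1 false) (f1 t.+1 true) (value k' t.+1) u v
  else stop_cost t false u v.

Lemma valueE k t u v : value k t u v =
  Num.min (Num.min (stop_cost t true u v) (stop_cost t false u v))
    (wait_cost k t u v).
Proof. by case: k. Qed.

Lemma gauge_stop_cost t m : (0 < t <= T1)%N -> gauge (stop_cost t m).
Proof. by move=> tT; apply: gauge_linear; exact: mean_cost_ge0. Qed.

Lemma gauge_value k t : (0 < t)%N -> (t + k <= T1)%N -> gauge (value k t).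
Proof.
elim: k t => [|k IH] t t0 tk.
  have tT : (0 < t <= T1)%N by rewrite t0 -(addn0 t).
  apply: gauge_min; last exact: gauge_stop_cost.
  by apply: gauge_min; exact: gauge_stop_cost.
have tT : (0 < t <= T1)%N by rewrite t0 (leq_trans _ tk)// leq_addr.
apply: gauge_min; first by apply: gauge_min; exact: gauge_stop_cost.
have [_ _ dens _] := model.
apply: gauge_average; [by have [] := dens t.+1 false isT
  |by have [] := dens t.+1 true isT|].
by apply: IH => //; rewrite addSnnS.
Qed.

Lemma gauge_wait_cost k t : (0 < t)%N -> (t + k <= T1)%N ->
  gauge (wait_cost k t).
Proof.
case: k => [|k] t0 tk; rewrite /wait_cost.
  by apply: gauge_stop_cost; rewrite t0 -(addn0 t).
have [_ _ dens _] := model.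
apply: gauge_average; [by have [] := dens t.+1 false isT
  |by have [] := dens t.+1 true isT|].
by apply: gauge_value => //; rewrite addSnnS.
Qed.

Lemma measurable_at_belief V t : gauge V -> (0 < t <= T1)%N ->
  measurable_fun setT (fun w => (V (q (X1 t w)) (1 - q (X1 t w)))%:E).
Proof.
move=> gV tT; have [mq _] := posterior_q tT.
have mqX : measurable_fun setT (fun w => q (X1 t w)) := measurableT_comp mq (@mX1 t).
apply/measurable_EFinP; apply: (measurableT_comp (gauge_measurable gV)
  (g := fun w => (q (X1 t w), 1 - q (X1 t w)))).
by apply: measurable_fun_pair => //; exact: measurable_funB.
Qed.

Lemma integral_wait_cost k t (B : set (t.-tuple E1)) : (0 < t)%N ->
  (t + k.+1 <= T1)%N -> measurable B ->
  (\int[P]_(w in X1 t @^-1` B)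
     (value k t.+1 (q (X1 t.+1 w)) (1 - q (X1 t.+1 w)))%:E =
   \int[P]_(w in X1 t @^-1` B)
     (wait_cost k.+1 t (q (X1 t w)) (1 - q (X1 t w)))%:E)%E.
Proof.
move=> t0 tk mB; have [_ mY dens _] := model.
have tT : (0 < t <= T1)%N by rewrite t0 (leq_trans _ tk)// leq_addr.
have tT' : (0 < t.+1 <= T1)%N.
  by rewrite (leq_trans _ tk)// addnS ltnS leq_addr.
have [mY1 _] := mY t.+1 isT.
have [mq' _] := posterior_q tT'.
have post' : posterior P D0 (fun w => (X1 t w, Y1 t.+1 w))
    (fun z => q (append z)).
  split; first exact: (measurableT_comp mq' (@measurable_append _ E1 t)).
  move=> C mC.
  have CE : (fun w => (X1 t w, Y1 t.+1 w)) @^-1` C =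
      X1 t.+1 @^-1` (@last_split _ _ t @^-1` C).
    by apply/seteqP; split => w /=; rewrite last_split_obs.
  under eq_integral do rewrite append_obs.
  rewrite CE; have [_ -> //] := posterior_q tT'.
  exact: (preimage_measurable (@measurable_last_split _ E1 t) mC).
have next1 : next_observation P (mu1 t.+1) (X1 t) (Y1 t.+1) (~` D0) (f1 t.+1 true).
  by rewrite /D0 setC_hypothesis; exact: (next_observation_model model).
have := bayes_average (@mX1 t) mY1 mD0 (dens t.+1 false isT).1
  (dens t.+1 true isT).1 (next_observation_model model false) next1
  (posterior_q tT) (@q01 t) post' (fun z => @q01 t.+1 (append z)).
have gV : gauge (value k t.+1) by apply: gauge_value => //; rewrite addSnnS.
move=> /(_ _ _ gV mB); rewrite /wait_cost => <-.
by apply: eq_integral => w _; rewrite append_obs.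
Qed.

Let cost t m w := random_cost pb T1 T2 c1 c2 J H Y1 Y2 (@send_at _ E1 t m) g2 w.

Definition choice_cost k t (x : R) (u : option bool) : R :=
  action_cost (stop_cost t true x (1 - x)) (stop_cost t false x (1 - x))
    (wait_cost k t x (1 - x)) u.

Definition greedy (g : policy1 E1) : Prop :=
  forall k t, (0 < t)%N -> (t + k = T1)%N ->
    {ae P, forall w, forall u,
      choice_cost k t (pi (X1 t w)) (g t (X1 t w)) <=
      choice_cost k t (pi (X1 t w)) u}.

Section one_policy.
Variable g : policy1 E1.
Arguments g : clear implicits.
Hypothesis adm1 : admissible1 T1 g.

Let total w := random_cost pb T1 T2 c1 c2 J H Y1 Y2 g g2 w.

Let alive t := [set w | forall s, (0 < s <= t)%N -> g s (X1 s w) = None].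
Let sends t m := alive t.-1 `&` [set w | g t (X1 t w) = Some m].

(** The costs of stopping and of waiting at time t can only be compared over
    events that are decided by the first t observations. *)
Let g_observed s t u : (0 < s <= t)%N -> (t <= T1)%N ->
  exists2 B, measurable B & [set w | g s (X1 s w) = u] = X1 t @^-1` B.
Proof.
move=> /andP[s0 st] tT; have [mg _] := adm1.
exists (truncate st @^-1` [set z | g s z = u]).
  apply: (preimage_measurable (measurable_truncate st)); apply: mg.
  by rewrite s0 (leq_trans st).
by apply/seteqP; split => w /=; rewrite truncate_obs.
Qed.

Let alive_observed s t : (s <= t <= T1)%N ->
  exists2 B, measurable B & alive s = X1 t @^-1` B.
Proof.
elim: s => [_|s IH /andP[st tT]].
  by exists setT => //; apply/seteqP; split => // w _ [|].
have [|B mB sB] := IH; first by rewrite tT ltnW.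
have [|//|C mC sC] := @g_observed s.+1 t None; first by rewrite st.
exists (B `&` C); first exact: measurableI.
rewrite preimage_setI -sB -sC; apply/seteqP; split => w /=.
  by move=> aw; split; [move=> r /andP[r0 rs]|]; apply: aw;
    rewrite ?ltnSn// r0 leqW.
move=> [aw gs] r /andP[r0]; rewrite leq_eqVlt => /predU1P[->//|rs].
by apply: aw; rewrite r0.
Qed.

Let sends_observed t m : (0 < t <= T1)%N ->
  exists2 B, measurable B & sends t m = X1 t @^-1` B.
Proof.
move=> /andP[t0 tT].
have [|B mB sB] := @alive_observed t.-1 t; first by rewrite leq_pred.
have [||C mC sC] := @g_observed t t (Some m); rewrite ?t0 ?leqnn//.
by exists (B `&` C); [exact: measurableI|rewrite preimage_setI -sB -sC].
Qed.

Let measurable_alive t : (t <= T1)%N -> measurable (alive t).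
Proof.
move=> tT; have [|B mB ->] := @alive_observed t t; first by rewrite leqnn.
exact: (preimage_measurable (@mX1 t) mB).
Qed.

Let measurable_sends t m : (0 < t <= T1)%N -> measurable (sends t m).
Proof.
move=> tT; have [B mB ->] := sends_observed m tT.
exact: (preimage_measurable (@mX1 t) mB).
Qed.

Let alive_split t : (0 < t)%N ->
  alive t.-1 = (sends t true `|` sends t false) `|` alive t.
Proof.
case: t => // t _ /=; apply/seteqP; split => w.
  move=> aw; case gt : (g t.+1 (X1 t.+1 w)) => [[]|].
  - by left; left.
  - by left; right.
  - right => s /andP[s0]; rewrite leq_eqVlt => /predU1P[->//|st].
    by apply: aw; rewrite s0.
move=> [[|]|]; [by case..|move=> aw s /andP[s0 st]].
by apply: aw; rewrite s0 leqW.
Qed.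

Let alive_T1 : alive T1 = set0.
Proof.
apply/seteqP; split => // w aw; have [_ /(_ (Y1 ^~ w))] := adm1; apply.
  by move=> t /andP[t0 tT]; apply: aw; rewrite t0 ltnW.
by apply: aw; rewrite T1_gt0 leqnn.
Qed.

Let integral_alive t (f : Omega -> R) : (0 < t <= T1)%N -> (forall w, 0 <= f w) ->
  (forall m, measurable_fun (sends t m) (fun w => (f w)%:E)) ->
  measurable_fun (alive t) (fun w => (f w)%:E) ->
  measurable_fun (alive t.-1) (fun w => (f w)%:E) /\
  (\int[P]_(w in alive t.-1) (f w)%:E =
   \int[P]_(w in sends t true) (f w)%:E + \int[P]_(w in sends t false) (f w)%:E
   + \int[P]_(w in alive t) (f w)%:E)%E.
Proof.
move=> tT f0 mfs mfa; have /andP[t0 tT1] := tT.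
have ms m := measurable_sends m tT; have ma := measurable_alive tT1.
have mss : measurable (sends t true `|` sends t false) by exact: measurableU.
have mfss : measurable_fun (sends t true `|` sends t false)
  (fun w => (f w)%:E) by apply/measurable_funU.
have mf : measurable_fun ((sends t true `|` sends t false) `|` alive t)
  (fun w => (f w)%:E) by apply/measurable_funU.
rewrite alive_split//; split => //.
rewrite ge0_integral_setU//.
- rewrite ge0_integral_setU//.
  + by move=> w _; rewrite lee_fin.
  + apply/disj_set2P/seteqP; split => // w [[_ /= g1] [_ /=]].
    by rewrite g1.
- by move=> w _; rewrite lee_fin.
- apply/disj_set2P/seteqP; split => // w [sw aw].
  have gtN : g t (X1 t w) = None by apply: aw; rewrite t0 leqnn.
  by case: sw => -[_ /=]; rewrite gtN.
Qed.

Let total_sends t m w : (0 < t <= T1)%N -> sends t m w -> total w = cost t m w.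
Proof.
move=> tT [aw gt]; apply: run_cost_stopped => //.
move=> s /andP[s0 st]; apply: aw; rewrite s0/=.
by case: t st {tT gt}.
Qed.

Let at_belief (V : R -> R -> R) t w := V (q (X1 t w)) (1 - q (X1 t w)).

Let le_value_stop k t m w :
  at_belief (value k t) t w <= at_belief (stop_cost t m) t w.
Proof. by rewrite /at_belief valueE !ge_min; case: m; rewrite lexx ?orbT. Qed.

Let le_value_wait k t w :
  at_belief (value k t) t w <= at_belief (wait_cost k t) t w.
Proof. by rewrite /at_belief valueE !ge_min lexx !orbT. Qed.

Let greedy_value k t : (0 < t)%N -> (t + k = T1)%N -> greedy g ->
  {ae P, forall w, match g t (X1 t w) with
    | Some m => at_belief (stop_cost t m) t w <= at_belief (value k t) t w
    | None => at_belief (wait_cost k t) t w <= at_belief (value k t) t w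
    end}.
Proof.
move=> t0 tk /(_ k t t0 tk) gg.
have tT : (0 < t <= T1)%N by rewrite t0 -tk leq_addr.
have p01 := ae_belief01 tT; apply: filterS2 gg p01 => w gw pw.
have qE : q (X1 t w) = pi (X1 t w) by exact: clamp_id.
move: gw; rewrite /at_belief qE /choice_cost => gw.
have w1 := gw (Some true); have w0 := gw (Some false); have wN := gw None.
by case: (g t (X1 t w)) w1 w0 wN => [[]|] /= w1 w0 wN;
  rewrite valueE !le_min ?w1 ?w0 ?wN ?lexx.
Qed.

Let total_ge0 w : 0 <= total w.
Proof. by rewrite /total /random_cost /run_cost !addr_ge0// mulr_ge0. Qed.

Let integral_sends k t m : (0 < t)%N -> (t + k = T1)%N ->
  [/\ measurable_fun (sends t m) (fun w => (total w)%:E),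
    (\int[P]_(w in sends t m) (at_belief (value k t) t w)%:E <=
     \int[P]_(w in sends t m) (total w)%:E)%E &
    greedy g ->
    (\int[P]_(w in sends t m) (total w)%:E <=
     \int[P]_(w in sends t m) (at_belief (value k t) t w)%:E)%E].
Proof.
move=> t0 tk; have tT : (0 < t <= T1)%N by rewrite t0 -tk leq_addr.
have gV : gauge (value k t) by apply: gauge_value; rewrite ?tk.
have gS : gauge (stop_cost t m) by exact: gauge_stop_cost.
have ms := measurable_sends m tT.
have mV := measurable_funTS (D := sends t m) (measurable_at_belief gV tT).
have mS := measurable_funTS (D := sends t m) (measurable_at_belief gS tT).
have V0 w : sends t m w -> (0 <= (at_belief (value k t) t w)%:E)%E.
  by move=> _; rewrite lee_fin; exact: gauge_ge0.
have S0 w : sends t m w -> (0 <= (at_belief (stop_cost t m) t w)%:E)%E.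
  by move=> _; rewrite lee_fin; exact: gauge_ge0.
have -> : (\int[P]_(w in sends t m) (total w)%:E =
    \int[P]_(w in sends t m) (at_belief (stop_cost t m) t w)%:E)%E.
  transitivity (\int[P]_(w in sends t m) (cost t m w)%:E)%E.
    by apply: eq_integral => w /set_mem sw; rewrite (total_sends tT sw).
  have [B mB ->] := sends_observed m tT.
  by rewrite (integral_stopping_cost model T1_gt0 T12 c1_ge0 c2_ge0 J_ge0
    adm2 m tT mB (posterior_q tT) (@q01 t)).
split.
- apply: (eq_measurable_fun (fun w => (cost t m w)%:E)).
    by move=> w /set_mem sw; rewrite (total_sends tT sw).
  apply: measurable_funTS; apply/measurable_EFinP.
  exact: (measurable_stopping_cost model).
- by apply: ge0_le_integral => // w _; rewrite lee_fin le_value_stop.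
- move=> /(greedy_value t0 tk) gg; apply: ae_ge0_le_integral => //.
  by apply: filterS gg => w /[swap] -[_ /= ->]; rewrite lee_fin.
Qed.

(** The claim of the backward induction, in which A is the event that no final
    message has been sent yet. *)
Let tail_optimality (V : Omega -> R) (A : set Omega) : Prop :=
  [/\ measurable_fun A (fun w => (total w)%:E),
    (\int[P]_(w in A) (V w)%:E <= \int[P]_(w in A) (total w)%:E)%E &
    greedy g ->
    (\int[P]_(w in A) (total w)%:E <= \int[P]_(w in A) (V w)%:E)%E].

Let backward_step k t : (0 < t)%N -> (t + k = T1)%N ->
  tail_optimality (at_belief (value k t) t) (alive t) ->
  tail_optimality (at_belief (value k t) t) (alive t.-1).
Proof.
move=> t0 tk [mfa le_a ge_a].
have tT : (0 < t <= T1)%N by rewrite t0 -tk leq_addr.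
have gV : gauge (value k t) by apply: gauge_value; rewrite ?tk.
have [mf1 le1 ge1] := integral_sends true t0 tk.
have [mf0 le0 ge0] := integral_sends false t0 tk.
have mfs m : measurable_fun (sends t m) (fun w => (total w)%:E) by case: m.
have mVs D := measurable_funTS (D := D) (measurable_at_belief gV tT).
have V0 w : 0 <= at_belief (value k t) t w by exact: gauge_ge0.
have [mf fE] := integral_alive tT total_ge0 mfs mfa.
have [_ VE] := integral_alive tT V0 (fun m => mVs (sends t m)) (mVs (alive t)).
split=> //; first by rewrite fE VE; do 2 (apply: leeD => //).
move=> gg; rewrite fE VE; apply: leeD; last exact: ge_a.
by apply: leeD; [exact: ge1|exact: ge0].
Qed.

Lemma dynamic_programming k t : (0 < t)%N -> (t + k = T1)%N ->
  tail_optimality (at_belief (value k t) t) (alive t.-1).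
Proof.
elim: k t => [|k IH] t t0 tk; apply: backward_step => //.
  have tE : t = T1 by rewrite -tk addn0.
  rewrite tE alive_T1; split; rewrite ?integral_set0//.
  exact: measurable_fun_set0.
have tT : (0 < t <= T1)%N by rewrite t0 -tk leq_addr.
have /andP[_ tT1] := tT.
have gV : gauge (value k.+1 t) by apply: gauge_value; rewrite ?tk.
have [//||mfa le_total ge_total] := IH t.+1; first by rewrite addSnnS.
have [|B mB aB] := @alive_observed t t; first by rewrite leqnn.
have tkT : (t + k.+1 <= T1)%N by rewrite tk.
have gW := gauge_wait_cost t0 tkT.
have waitE : (\int[P]_(w in alive t) (at_belief (value k t.+1) t.+1 w)%:E =
    \int[P]_(w in alive t) (at_belief (wait_cost k.+1 t) t w)%:E)%E.
  by rewrite aB; exact: (integral_wait_cost t0 tkT mB).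
have ma := measurable_alive tT1.
have mV := measurable_funTS (D := alive t) (measurable_at_belief gV tT).
have mW := measurable_funTS (D := alive t) (measurable_at_belief gW tT).
have V0 w : alive t w -> (0 <= (at_belief (value k.+1 t) t w)%:E)%E.
  by move=> _; rewrite lee_fin; exact: gauge_ge0.
have W0 w : alive t w -> (0 <= (at_belief (wait_cost k.+1 t) t w)%:E)%E.
  by move=> _; rewrite lee_fin; exact: gauge_ge0.
split => //.
- apply: le_trans le_total; rewrite waitE.
  by apply: ge0_le_integral => // w _; rewrite lee_fin le_value_wait.
- move=> gg; apply: le_trans (ge_total gg) _; rewrite waitE.
  have := greedy_value t0 tk gg => gv; apply: ae_ge0_le_integral => //.
  apply: filterS gv => w /[swap] aw.
  have -> : g t (X1 t w) = None by apply: aw; rewrite t0 leqnn.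
  by rewrite lee_fin.
Qed.

Lemma expected_cost_value :
  let V := (\int[P]_w (at_belief (value T1.-1 1) 1 w)%:E)%E in
  let C := expected_cost P pb T1 T2 c1 c2 J H Y1 Y2 g g2 in
  (V <= C)%E /\ (greedy g -> (C <= V)%E).
Proof.
have T1E : (1 + T1.-1 = T1)%N by rewrite add1n prednK.
have [_ leV geV] := dynamic_programming (ltn0Sn 0) T1E.
rewrite /expected_cost unlock; have alive0 : alive 1.-1 = setT.
  by apply/seteqP; split => // w _ [|].
by rewrite alive0 in leV geV.
Qed.

End one_policy.

(** Backward induction bounds the cost of every policy from below by the value
    at time 1, which a greedy policy attains. *)
Lemma greedy_optimal g : admissible1 T1 g -> greedy g ->
  optimal1 P pb T1 T2 c1 c2 J H Y1 Y2 g g2.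
Proof.
move=> adm gg; split=> // g' adm'.
have [_ /(_ gg) ge] := expected_cost_value adm.
have [le _] := expected_cost_value adm'.
exact: le_trans ge le.
Qed.

End dynamic_programming.

(** * Renaming the final messages *)

Section renaming.
Context {R : realType} {E1 E2 : Type}.
Variable sigma : nat -> bool.

Definition rename_messages (z : seq (option bool)) : seq (option bool) :=
  mkseq (fun i => rename sigma i.+1 (nth None z i)) (size z).

Lemma renameK t : involutive (rename sigma t).
Proof. by case=> [m|] //=; rewrite addKb. Qed.

Lemma rename_messages_received pb t z :
  rename_messages (received pb t z) = received pb t (rename_messages z).
Proof.
case: pb => //=; apply: (@eq_from_nth _ None); rewrite !size_mkseq.
  by rewrite !size_take size_mkseq.
move=> i it; rewrite nth_mkseq//; move: it; rewrite size_take => it.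
have [it' iz] : (i < t)%N /\ (i < size z)%N.
  by move: it; case: (ltnP t (size z)) => tz it //; split => //; 
    [exact: (ltn_trans it tz)|exact: (leq_trans it tz)].
by rewrite !nth_take// nth_mkseq.
Qed.

Lemma tau1_rename T1 (g : policy1 E1) y :
  tau1 T1 (rename1 sigma g) y = tau1 T1 g y.
Proof.
rewrite /tau1 /first_time; congr (_ + _)%N; apply: eq_find => t.
by rewrite /rename1; case: (g t _).
Qed.

Lemma messages_rename T1 (g : policy1 E1) y :
  messages T1 (rename1 sigma g) y = rename_messages (messages T1 g y).
Proof.
rewrite /messages tau1_rename; apply: (@eq_from_nth _ None).
  by rewrite size_mkseq !size_map.
move=> i; rewrite size_map size_iota => it.
rewrite nth_mkseq ?size_map ?size_iota//.
by rewrite !(nth_map 0%N) ?size_iota// nth_iota// add1n.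
Qed.

Lemma run_cost_rename pb T1 T2 (c1 c2 : R) J (g : policy1 E1)
    (g2 : policy2 E2) y y' h :
  run_cost pb T1 T2 c1 c2 J g (rename2 sigma g2) y y' h =
  run_cost pb T1 T2 c1 c2 J (rename1 sigma g) g2 y y' h.
Proof.
have act t : action2 pb T1 g (rename2 sigma g2) y y' t =
    action2 pb T1 (rename1 sigma g) g2 y y' t.
  rewrite /action2 /rename2 messages_rename -rename_messages_received.
  by [].
have tau : tau2 pb T1 T2 g (rename2 sigma g2) y y' =
    tau2 pb T1 T2 (rename1 sigma g) g2 y y'.
  by rewrite /tau2 /first_time; congr (_ + _)%N; apply: eq_find => t; rewrite act.
by rewrite /run_cost /decision tau act tau1_rename.
Qed.

End renaming.

Section renaming_admissible.
Context {d : measure_display} {E : measurableType d}.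
Variable sigma : nat -> bool.

Lemma admissible1_rename T1 (g : policy1 E) : admissible1 T1 g ->
  admissible1 T1 (rename1 sigma g).
Proof.
move=> [mg stop]; split=> [t m tT|y none].
  rewrite (_ : [set _ | _] = [set y | g t y = rename sigma t m]).
    exact: mg.
  apply/seteqP; split => y; rewrite /rename1/=; first by move=> <-; rewrite renameK.
  by move=> ->; rewrite renameK.
have {}none t : (0 < t < T1)%N -> g t (obs t y) = None.
  by move=> /none; rewrite /rename1; case: (g t _).
by have := stop y none; rewrite /rename1; case: (g T1 _).
Qed.

Lemma admissible2_rename pb T1 T2 (g2 : policy2 E) : admissible2 pb T1 T2 g2 ->
  admissible2 pb T1 T2 (rename2 sigma g2).
Proof.
move=> [mg stop]; split=> [t z u tT|y z [t [m [tT zE]]]]; first exact: mg.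
have zE' : rename_messages sigma z = rcons (nseq t.-1 None) (Some (sigma t (+) m)).
  rewrite zE; apply: (@eq_from_nth _ None).
    by rewrite size_mkseq !size_rcons !size_nseq.
  move=> i; rewrite size_mkseq => it; rewrite nth_mkseq// !nth_rcons.
  rewrite !size_nseq !nth_nseq; case: ltnP => //= ti.
  case: eqP => // ->; rewrite prednK//; by case/andP: tT.
have pz : possible_messages T1 (rename_messages sigma z).
  by exists t, (sigma t (+) m).
have renE s : rename2 sigma g2 (obs s y) (received pb s z) =
    g2 s (obs s y) (received pb s (rename_messages sigma z)).
  by rewrite -rename_messages_received.
move=> none; rewrite renE; apply: stop => // s /none; rewrite renE.
by [].
Qed.

End renaming_admissible.

(** * Optimal threshold policies *)

Section threshold_policies.
Context {R : realType} {d : measure_display} {E : measurableType d}.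

Let measurable_if (b : R -> bool) (u v : R -> option bool) m :
  measurable [set x | b x] -> measurable [set x | u x = m] ->
  measurable [set x | v x = m] ->
  measurable [set x | (if b x then u x else v x) = m].
Proof.
move=> mb mu mv.
rewrite (_ : [set x | _] = ([set x | b x] `&` [set x | u x = m]) `|`
  (~` [set x | b x] `&` [set x | v x = m])).
  by apply: measurableU; apply: measurableI => //; exact: measurableC.
apply/seteqP; split => x /=.
  by case: (b x) => bx; [left|right].
by case: (b x) => -[] [].
Qed.

Let measurable_const (u m : option bool) : measurable [set _ : R | u = m].
Proof.
have [->|um] := pselect (u = m).
  by rewrite (_ : [set _ | _] = setT)//; apply/seteqP; split.
by rewrite (_ : [set _ | _] = set0)//; apply/seteqP; split.
Qed.

Let measurable_lt (a : R) : measurable [set x : R | x < a].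
Proof.
rewrite (_ : [set x | x < a] = `]-oo, a[%classic); first exact: measurable_itv.
by apply/seteqP; split => x /=; rewrite in_itv.
Qed.

Let measurable_le (a : R) : measurable [set x : R | x <= a].
Proof.
rewrite (_ : [set x | x <= a] = `]-oo, a]%classic); first exact: measurable_itv.
by apply/seteqP; split => x /=; rewrite in_itv.
Qed.

Lemma admissible1_threshold T1 (pi : forall t : nat, t.-tuple E -> R)
    (al be de th : nat -> R) :
  (forall t, (0 < t <= T1)%N -> measurable_fun setT (@pi t)) ->
  admissible1 T1 (threshold_policy T1 pi al be de th).
Proof.
move=> mpi; split=> [t m tT|y _]; last first.
  by rewrite /threshold_policy eqxx; case: ifP.
rewrite /threshold_policy; case: eqP => _.
  have mA := measurable_if (measurable_le (al t)) (measurable_const (Some true) m)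
    (measurable_const (Some false) m).
  exact: (preimage_measurable (mpi t tT) mA).
have mA := measurable_if (measurable_lt (al t)) (measurable_const None m)
  (measurable_if (measurable_le (be t)) (measurable_const (Some true) m)
  (measurable_if (measurable_lt (de t)) (measurable_const None m)
  (measurable_if (measurable_le (th t)) (measurable_const (Some false) m)
    (measurable_const None m)))).
exact: (preimage_measurable (mpi t tT) mA).
Qed.

End threshold_policies.

Section optimal_thresholds.
Context {R : realType} {d d1 d2 : measure_display}.
Context {Omega : measurableType d} {E1 : measurableType d1}
  {E2 : measurableType d2}.
Variables (P : probability Omega R) (H : Omega -> bool)
  (Y1 : nat -> Omega -> E1) (Y2 : nat -> Omega -> E2)
  (mu1 : nat -> {sigma_finite_measure set E1 -> \bar R})
  (mu2 : nat -> {sigma_finite_measure set E2 -> \bar R})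
  (f1 : nat -> bool -> E1 -> R) (f2 : nat -> bool -> E2 -> R).
Hypothesis model : observation_model P H Y1 Y2 mu1 mu2 f1 f2.
Variables (pb : problem) (T1 T2 : nat) (c1 c2 : R) (J : bool -> bool -> R)
  (g2 : policy2 E2).
Hypotheses (T1_gt0 : (0 < T1)%N) (T12 : pb = P2 -> (T1 <= T2)%N)
  (c1_ge0 : 0 <= c1) (c2_ge0 : 0 <= c2) (J_ge0 : forall u h, 0 <= J u h)
  (adm2 : admissible2 pb T1 T2 g2).
Variable pi : forall t : nat, t.-tuple E1 -> R.
Arguments pi : clear implicits.
Hypothesis belief : is_belief P H Y1 T1 pi.

Let X1 t w := obs t (Y1 ^~ w).
Let mean := mean_cost P H Y1 Y2 pb T1 T2 c1 c2 J g2.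

(** The names are exchanged when, under H = 1, the message 1 costs more on
    average than the message 0.  After the exchange 1 is at least as good as 0 at
    the belief 0, as [threshold_action_optimal] requires. *)
Definition swapped (t : nat) : bool :=
  (0 < t <= T1)%N && (mean t false true < mean t true true).

Lemma swapped_inconsistent t : swapped t -> (0 < t <= T1)%N /\
  ~ label_consistent P pb T1 T2 c1 c2 J H Y1 Y2 g2 t.
Proof.
move=> /andP[tT lt]; split => // /(_ true); rewrite leNgt => /negP; apply.
have fin m := integral_cost_fin model T1_gt0 T12 c1_ge0 c2_ge0 J_ge0 adm2 m true tT.
rewrite -(fineK (fin false)) -(fineK (fin true)) lte_fin.
move: lt; rewrite /mean /mean_cost.
have := fine_ge0 (measure_ge0 P [set w | H w = true]).
rewrite le_eqVlt => /predU1P[<-|p0]; first by rewrite invr0 !mulr0 ltxx.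
by rewrite ltr_pM2r// invr_gt0.
Qed.

(** The mean cost of the message that is called m once the names are
    exchanged. *)
Let a t m := mean t (swapped t (+) m) false.
Let b t m := mean t (swapped t (+) m) true.

Let b_le t : (0 < t <= T1)%N -> b t true <= b t false.
Proof.
move=> tT; rewrite /b; case: (boolP (swapped t)) => /=.
  by move=> /andP[_ /ltW].
by rewrite negb_and tT /= -leNgt.
Qed.

Let choice_cost_label k t x u : 0 <= x <= 1 ->
  choice_cost P H Y1 Y2 mu1 f1 pb T1 T2 c1 c2 J g2 k t x
    (rename swapped t u) =
  action_cost (affine (a t true) (b t true) x) (affine (a t false) (b t false) x)
    (wait_cost P H Y1 Y2 mu1 f1 pb T1 T2 c1 c2 J g2 k t x (1 - x)) u.
Proof.
move=> /andP[x0 x1]; have x1' : 0 <= 1 - x by rewrite subr_ge0.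
rewrite /choice_cost /stop_cost !ger0_norm// /a /b /mean /affine.
by rewrite /rename; case: u => [[]|]; case: (swapped t) => //=; ring.
Qed.

Let label_cost k t x u := action_cost (affine (a t true) (b t true) x)
  (affine (a t false) (b t false) x)
  (wait_cost P H Y1 Y2 mu1 f1 pb T1 T2 c1 c2 J g2 k t x (1 - x)) u.

Let thresholds_before k t : (0 < t)%N -> (t + k = T1)%N ->
  exists p : (R * R) * (R * R),
    [/\ 0 <= p.1.1, p.1.1 <= p.1.2, p.1.2 <= p.2.1, p.2.1 <= p.2.2 &
        p.2.2 <= 1] /\
    {ae P, forall w, forall u, let x := pi t (X1 t w) in
      label_cost k t x (threshold_action p.1.1 p.1.2 p.2.1 p.2.2 x) <=
      label_cost k t x u}.
Proof.
move=> t0 tk; have tT : (0 < t <= T1)%N by rewrite t0 -tk leq_addr.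
have [mpi _] := belief tT.
have gW := gauge_wait_cost model T1_gt0 T12 c1_ge0 c2_ge0 J_ge0 adm2 t0
  (eq_leq tk).
have mX : measurable_fun setT (X1 t) := measurable_X1 model (t := t).
have mpiX : measurable_fun setT (fun w => pi t (X1 t w)) := measurableT_comp mpi mX.
have [al [be [de [th [e [ord Pe opt]]]]]] := threshold_action_optimal
  (a t true) (a t false) (gauge_concave01 gW) (gauge_lipschitz01 gW) (b_le tT)
  (fun l r lr => nonatom_between P mpiX lr).
exists ((al, be), (de, th)); split => //.
have not_e : {ae P, forall w, pi t (X1 t w) <> e}.
  exists ((fun w => pi t (X1 t w)) @^-1` [set e]); split => //.
    exact: (preimage_measurable mpiX (measurable_set1 e)).
  by move=> w /= /contrapT.
apply: filterS2 not_e (ae_belief01 model belief tT) => w xe x01 u /=.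
exact: opt.
Qed.

(** At the horizon only the two messages are compared.  The difference of their
    costs is affine in the belief, so the beliefs at which 1 is a best message
    form an interval that contains 0. *)
Let threshold_last : exists2 al : R, 0 <= al <= 1 &
  forall x, 0 <= x <= 1 -> forall u,
    label_cost 0 T1 x (if x <= al then Some true else Some false) <=
    label_cost 0 T1 x u.
Proof.
have TT : (0 < T1 <= T1)%N by rewrite T1_gt0 leqnn.
pose phi x := affine (a T1 false) (b T1 false) x - affine (a T1 true) (b T1 true) x.
have [|||l [r [l0 lr r1 phiP]]] := @superlevel_interval _ phi.
- exact: concave01B_affine (concave01_affine _ _).
- exact: lipschitz01B_affine (lipschitz01_affine _ _).
- exists 0; first by rewrite lexx ler01.
  by rewrite /phi /affine; have := b_le TT; lra.
have l00 : l = 0.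
  have /phiP : 0 <= (0 : R) <= 1 by rewrite lexx ler01.
  have -> : 0 <= phi 0 by rewrite /phi /affine; have := b_le TT; lra.
  move=> [/(_ isT) /andP[l0' _] _]; exact/le_anti/andP.
exists r; first by rewrite r1 (le_trans _ lr).
move=> x x01; have [x0 x1] := andP x01; have x1' : 0 <= 1 - x by rewrite subr_ge0.
have waitE : label_cost 0 T1 x None = label_cost 0 T1 x (Some (swapped T1)).
  rewrite /label_cost /= /stop_cost !ger0_norm// /a /b /mean /affine.
  by case: (swapped T1) => /=; ring.
have phix := phiP x x01; rewrite l00 x0/= in phix.
have best : label_cost 0 T1 x (if x <= r then Some true else Some false) <=
    Num.min (label_cost 0 T1 x (Some true)) (label_cost 0 T1 x (Some false)).
  rewrite le_min; case: ifPn => xr; rewrite lexx ?andbT/=.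
    by have := phix.2 xr; rewrite subr_ge0.
  have : ~ 0 <= phi x by move=> /phix.1; apply/negP.
  by move=> /negP; rewrite -ltNge subr_lt0 => /ltW.
by move=> u; apply: le_trans best _; case: u => [m|];
  rewrite ?waitE; [case: m|case: (swapped T1)]; rewrite ge_min lexx ?orbT.
Qed.

Lemma optimal_thresholds : exists alpha beta delta theta : nat -> R,
  let g1 := threshold_policy T1 pi alpha beta delta theta in
  [/\ 0 <= alpha T1 <= 1,
    forall k, (0 < k < T1)%N ->
      [/\ 0 <= alpha k, alpha k <= beta k, beta k <= delta k,
          delta k <= theta k & theta k <= 1],
    admissible1 T1 g1 &
    optimal1 P pb T1 T2 c1 c2 J H Y1 Y2 (rename1 swapped g1) g2].
Proof.
have [aT aT01 aTopt] := threshold_last.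
have [p pP] : exists p : nat -> (R * R) * (R * R), forall t, (0 < t <= T1)%N ->
    [/\ 0 <= (p t).1.1, (p t).1.1 <= (p t).1.2, (p t).1.2 <= (p t).2.1,
      (p t).2.1 <= (p t).2.2 & (p t).2.2 <= 1] /\
    {ae P, forall w, forall u, let x := pi t (X1 t w) in
      label_cost (T1 - t) t x
        (threshold_action (p t).1.1 (p t).1.2 (p t).2.1 (p t).2.2 x) <=
      label_cost (T1 - t) t x u}.
  pose good t (q : (R * R) * (R * R)) : Prop := (0 < t <= T1)%N ->
    [/\ 0 <= q.1.1, q.1.1 <= q.1.2, q.1.2 <= q.2.1, q.2.1 <= q.2.2 &
      q.2.2 <= 1] /\
    {ae P, forall w, forall u, let x := pi t (X1 t w) in
      label_cost (T1 - t) t x (threshold_action q.1.1 q.1.2 q.2.1 q.2.2 x) <=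
      label_cost (T1 - t) t x u}.
  suff /choice[p pP] : forall t, exists q, good t q by exists p.
  move=> t; have [tT|tT] := boolP (0 < t <= T1)%N; last first.
    by exists ((0, 0), (0, 0)); rewrite /good (negbTE tT).
  have [t0 tT1] := andP tT.
  have [q qP] := thresholds_before t0 (subnKC tT1).
  by exists q.
exists (fun t => if t == T1 then aT else (p t).1.1), (fun t => (p t).1.2),
  (fun t => (p t).2.1), (fun t => (p t).2.2).
set g1 := threshold_policy _ _ _ _ _ _ => /=.
have adm : admissible1 T1 g1.
  by apply: admissible1_threshold => t /belief[].
split=> //; first by rewrite eqxx.
  move=> k /andP[k0 kT]; rewrite (ltn_eqF kT).
  by have [|ord _] := pP k => //; rewrite k0 ltnW.
apply: (greedy_optimal model T1_gt0 T12 c1_ge0 c2_ge0 J_ge0 adm2 belief).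
  exact: admissible1_rename.
move=> k t t0 tk; have tT : (0 < t <= T1)%N by rewrite t0 -tk leq_addr.
have kE : (T1 - t = k)%N by rewrite -tk addKn.
have reduce : {ae P, forall w, forall u,
    label_cost k t (pi t (X1 t w)) (g1 t (X1 t w)) <=
    label_cost k t (pi t (X1 t w)) u}.
  have [tE|tN] := eqVneq t T1.
    subst t; have k0 : k = 0%N by rewrite -kE subnn.
    apply: filterS (ae_belief01 model belief tT) => w x01 u.
    by rewrite /g1 /threshold_policy eqxx k0; exact: aTopt.
  have [_] := pP t tT; rewrite kE; apply: filterS => w opt u.
  rewrite /g1 /threshold_policy (negbTE tN); exact: opt.
apply: filterS2 reduce (ae_belief01 model belief tT) => w opt x01 u.
rewrite -[u](renameK swapped t) /rename1 !choice_cost_label//.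
exact: opt.
Qed.

End optimal_thresholds.

Theorem theorem2 (R : realType) (d d1 d2 : measure_display)
  (Omega : measurableType d) (E1 : measurableType d1) (E2 : measurableType d2)
  (P : probability Omega R)
  (H : Omega -> bool) (p0 : R)
  (Y1 : nat -> Omega -> E1) (Y2 : nat -> Omega -> E2)
  (mu1 : nat -> {sigma_finite_measure set E1 -> \bar R})
  (mu2 : nat -> {sigma_finite_measure set E2 -> \bar R})
  (f1 : nat -> bool -> E1 -> R) (f2 : nat -> bool -> E2 -> R)
  (pb : problem) (T1 T2 : nat) (c1 c2 L : R) (J : bool -> bool -> R)
  (pi : forall t : nat, t.-tuple E1 -> R)
  (g2 : policy2 E2) :
  P [set w | H w = false] = p0%:E ->
  observation_model P H Y1 Y2 mu1 mu2 f1 f2 ->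
  (0 < T1)%N ->
  (pb = P2 -> (T1 <= T2)%N) ->
  0 < c1 -> 0 < c2 ->
  (forall u h, 0 <= J u h <= L) ->
  J true true < J false true -> J false false < J true false ->
  is_belief P H Y1 T1 pi ->
  admissible2 pb T1 T2 g2 ->
  exists (alpha beta delta theta : nat -> R) (sigma : nat -> bool),
    let g1 := threshold_policy T1 pi alpha beta delta theta in
    let cost := expected_cost P pb T1 T2 c1 c2 J H Y1 Y2 in
    let optimal := optimal1 P pb T1 T2 c1 c2 J H Y1 Y2 in
    [/\ 0 <= alpha T1 <= 1,
        forall k, (0 < k < T1)%N ->
          [/\ 0 <= alpha k, alpha k <= beta k, beta k <= delta k,
              delta k <= theta k & theta k <= 1],
        optimal (rename1 sigma g1) g2,
        [/\ admissible2 pb T1 T2 (rename2 sigma g2),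
            optimal g1 (rename2 sigma g2) &
            cost g1 (rename2 sigma g2) = cost (rename1 sigma g1) g2] &
        forall t, sigma t ->
          (0 < t <= T1)%N /\
          ~ label_consistent P pb T1 T2 c1 c2 J H Y1 Y2 g2 t].
Proof.
move=> _ model T1_gt0 T12 /ltW c1_ge0 /ltW c2_ge0 J0L _ _ belief adm2.
have J_ge0 u h : 0 <= J u h by case/andP: (J0L u h).
have [al [be [de [th [aT01 ord adm opt]]]]] := optimal_thresholds model T1_gt0
  T12 c1_ge0 c2_ge0 J_ge0 adm2 belief.
set sigma := swapped _ _ _ _ _ _ _ _ _ _ _ in opt.
exists al, be, de, th, sigma => g1 cost optimal.
have costE g : cost g (rename2 sigma g2) = cost (rename1 sigma g) g2.
  rewrite /cost /expected_cost; congr expectation; apply/funext => w.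
  exact: run_cost_rename.
split => //.
- split; [exact: admissible2_rename| |exact: costE].
  split => // g admg; rewrite -/(cost _ _) -/(cost g _) !costE.
  exact: opt.2 _ (admissible1_rename sigma admg).
- exact: (swapped_inconsistent model T1_gt0 T12 c1_ge0 c2_ge0 J_ge0 adm2).
Qed.
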